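(* Let $1\le p_1<\dots<p_n<\infty$ and $p\in[1,\infty)\setminus\{p_1,\dots,p_n\}$. Then neither $T^p$ nor $\ell_p$ coarse Lipschitz embeds into $T^{p_1}\oplus\dots\oplus T^{p_n}$. In particular, $T^p$ does not coarse Lipschitz embed into $T^q$ for all $p,q\in[1,\infty)$ with $p\ne q$.
   Context: $c_{00}$ is the space of eventually zero real sequences, $\|x\|_0=\max|x_n|$; for finite $E\subset\mathbb N$, $Ex$ is the restriction of $x$ to $E$; $E<F$ means $\max E<\min F$, $k\le E$ means $k\le\min E$. The Tsirelson space $T$ is the completion of $c_{00}$ under the unique norm with $\|x\|=\max\{\|x\|_0,\frac12\sup\sum_{j=1}^k\|E_jx\|\}$, sup over $k$ and finite sets $k\le E_1<\dots<E_k$. For $p\in[1,\infty)$, $T^p$ (the $p$-convexification) is the space of real sequences $(x_n)$ with $\sum|x_n|^pe_n\in T$, with norm $\|x\|_p=\|\sum|x_n|^pe_n\|_T^{1/p}$. A map $f$ between metric spaces is a coarse Lipschitz embedding if for some $L>0$, $\omega_f(t)\le Lt+L$ and $\rho_f(t)\ge L^{-1}t-L$ for all $t\ge0$, where $\omega_f(t)=\sup\{d(f(x),f(y)):d(x,y)\le t\}$, $\rho_f(t)=\inf\{d(f(x),f(y)):d(x,y)\ge t\}$. Finite direct sums carry any of the equivalent product norms. *)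

(* Defs.v *)
From Stdlib Require Import Reals Lra Lia List Classical ClassicalEpsilon.
Import ListNotations.
Open Scope R_scope.

(* Rsup P = least upper bound of P when P is nonempty and bounded above,
   and 0 (junk value) otherwise. *)
Definition Rsup (P : R -> Prop) : R :=
  match excluded_middle_informative (bound P /\ exists x, P x) with
  | left H => proj1_sig (completeness P (proj1 H) (proj2 H))
  | right _ => 0
  end.

Definition rpow (a e : R) : R :=
  if Rlt_dec 0 a then Rpower a e else 0.
Definition rroot (a p : R) : R := rpow a (/ p).

Fixpoint rsum (n : nat) (f : nat -> R) : R :=
  match n with O => 0 | S m => rsum m f + f m end.

(* A real sequence is nat -> R; the coordinate i : nat stands for the
   element i+1 of N = {1,2,3,...}. *)
Definition c00 (x : nat -> R) : Prop :=
  exists N : nat, forall k, (N <= k)%nat -> x k = 0.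

Definition seq_sub (x y : nat -> R) : nat -> R := fun k => x k - y k.

Definition norm0 (x : nat -> R) : R := Rsup (fun r => exists k, r = Rabs (x k)).

Definition restr (E : list nat) (x : nat -> R) : nat -> R :=
  fun k => if in_dec Nat.eq_dec k E then x k else 0.

(* Admissible families k <= E_1 < ... < E_k of nonempty finite sets of N.
   Coordinate a : nat represents the natural number a+1. *)
Definition admissible (Es : list (list nat)) : Prop :=
  (forall E, In E Es -> E <> []) /\
  (forall a, In a (nth 0 Es []) -> (length Es <= S a)%nat) /\
  (forall i j, (i < j)%nat -> (j < length Es)%nat ->
     forall a b, In a (nth i Es []) -> In b (nth j Es []) -> (a < b)%nat).

(* Figiel--Johnson iteration defining Tsirelson's norm on c00:
   |x|_0 = ||x||_0,
   |x|_{m+1} = max(||x||_0, 1/2 sup sum_j |E_j x|_m) over admissible families. *)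
Fixpoint tsir_iter (m : nat) (x : nat -> R) : R :=
  match m with
  | O => norm0 x
  | S m' => Rmax (norm0 x)
      (/ 2 * Rsup (fun r => exists Es, admissible Es /\
                     r = fold_right (fun E acc => tsir_iter m' (restr E x) + acc) 0 Es))
  end.

(* The Tsirelson norm on c00 (the unique norm satisfying the implicit
   equation of the paper) = limit (= sup) of the iterates. *)
Definition tsir_c00 (x : nat -> R) : R := Rsup (fun r => exists m, r = tsir_iter m x).

Definition trunc (m : nat) (x : nat -> R) : nat -> R :=
  fun k => if Nat.ltb k m then x k else 0.

(* The Tsirelson space T = completion of c00, realised as the space of
   sequences whose truncations form a Cauchy sequence in Tsirelson's norm;
   its norm is the limit of the norms of the truncations. *)
Definition in_T (x : nat -> R) : Prop :=
  forall eps, eps > 0 -> exists N : nat, forall m k, (N <= m)%nat -> (N <= k)%nat ->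
    tsir_c00 (seq_sub (trunc m x) (trunc k x)) < eps.

Definition T_norm (x : nat -> R) : R :=
  Rsup (fun l => Un_cv (fun m => tsir_c00 (trunc m x)) l).

Definition pw (p : R) (x : nat -> R) : nat -> R := fun k => rpow (Rabs (x k)) p.
Definition in_Tp (p : R) (x : nat -> R) : Prop := in_T (pw p x).
Definition Tp_norm (p : R) (x : nat -> R) : R := rroot (T_norm (pw p x)) p.
Definition Tp_dist (p : R) (x y : nat -> R) : R := Tp_norm p (seq_sub x y).

Definition in_lp (p : R) (x : nat -> R) : Prop :=
  exists S, Un_cv (fun N => sum_f_R0 (pw p x) N) S.
Definition lp_norm (p : R) (x : nat -> R) : R :=
  rroot (Rsup (fun S => Un_cv (fun N => sum_f_R0 (pw p x) N) S)) p.
Definition lp_dist (p : R) (x y : nat -> R) : R := lp_norm p (seq_sub x y).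

(* Direct sum T^{ps 0} (+) ... (+) T^{ps (n-1)}, elements are families
   y : nat -> (nat -> R) with y i in T^{ps i} for i < n and y i = 0 for i >= n,
   with the l_1 product norm (any equivalent product norm may be used). *)
Definition in_sumTp (n : nat) (ps : nat -> R) (y : nat -> nat -> R) : Prop :=
  (forall i, (i < n)%nat -> in_Tp (ps i) (y i)) /\
  (forall i k, (n <= i)%nat -> y i k = 0).
Definition sumTp_dist (n : nat) (ps : nat -> R) (y z : nat -> nat -> R) : R :=
  rsum n (fun i => Tp_dist (ps i) (y i) (z i)).

(* omega_f(t) <= b  and  rho_f(t) >= b, written out (sup / inf) *)
Definition omega_le {A B} (inA : A -> Prop) (dA : A -> A -> R) (dB : B -> B -> R)
  (f : A -> B) (t b : R) : Prop :=
  forall x y, inA x -> inA y -> dA x y <= t -> dB (f x) (f y) <= b.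
Definition rho_ge {A B} (inA : A -> Prop) (dA : A -> A -> R) (dB : B -> B -> R)
  (f : A -> B) (t b : R) : Prop :=
  forall x y, inA x -> inA y -> dA x y >= t -> dB (f x) (f y) >= b.

Definition coarse_lip_embeds {A B} (inA : A -> Prop) (dA : A -> A -> R)
  (inB : B -> Prop) (dB : B -> B -> R) : Prop :=
  exists f : A -> B, (forall x, inA x -> inB (f x)) /\
    exists L, L > 0 /\ forall t, 0 <= t ->
      omega_le inA dA dB f t (L * t + L) /\ rho_ge inA dA dB f t (t / L - L).

(* Main.v *)
From Stdlib Require Import Reals Lra Lia List Compare_dec.
From Stdlib Require Import Classical ClassicalEpsilon FunctionalExtensionality.
From mathcomp Require filter.
Require Import Defs.
Import ListNotations.
Open Scope R_scope.

(** Call a lattice norm on [c00] with normalised unit vectors and a lower l_1-estimate on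
    admissible families of intervals a [bnorm]. Tsirelson's norm and the l_1 norm are both of this
    kind, and [T^p] and [l_p] are the p-convexifications. Such a convexification has upper
    p-estimates with constant 1 on disjoint vectors, it is boundedly complete, and counting the
    blocks above each dyadic level shows that it has lower r-estimates on successive vectors for
    every [r > p].

    Suppose [f] coarse Lipschitz embeds the source, of exponent [p], into the sum. For the summands
    with [p_i < p], fix [r] strictly between and renorm by the lower r-estimate. Approximate
    midpoints of an almost extremal pair for the large-scale Lipschitz constant contain, in the
    source, a ball of radius [d^(1/p)] of a finite-codimensional subspace, while in the target they
    lie within [O(d^(1/r))] of a finite-dimensional set; since [r < p], these components of [f] are
    compressed on balls of arbitrarily large radius [s]. For the summands with [p_i > p], restrict
    [f] to the vectors [s k^(-1/p) (e_(n_1) + ... + e_(n_k))] of such a ball and take iterated weak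
    limits along an ultrafilter: the increments are almost disjoint for suitable tuples, so [f]
    stays within [O(s k^(1/p_i - 1/p))] of a fixed point. Two disjoint tuples are then mapped to
    points at distance [o(s)], although the vectors themselves are at distance at least [s]. *)

(** * Suprema, powers and finite sums *)

(** The obstacle is that [T^p] matches its upper [p]-estimate from below only on admissible
    families. A lower estimate for all successive vectors has to be bought with an exponent
    [r > p_i], which the strict inequality [p_i < p] leaves room for. On singletons far out,
    admissibility does give a lower [p]-estimate with constant 2, and the union of two tuples of
    length [k] makes up for this 2. Neither method covers all summands: midpoints give nothing when
    [p_i > p], and [k^(1/p_i - 1/p)] does not decay when [p_i < p]. Both must therefore act on the
    same vectors, which dictates the order of the choices. The length [k] depends only on [L], [n]
    and the exponents and comes first. Then comes the radius [s], so large that [s k^(-1/p) >= 1],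
    which absorbs the additive constants. The finite-dimensional cuts in source and target follow,
    and the tuples, placed beyond the cut of the source, come last. Compression controls only the
    tails of the small-exponent components. Their heads are bounded in finitely many coordinates, so
    they converge along the ultrafilter, and two tuples far apart have nearly equal heads. *)

Lemma Rsup_ub (P : R -> Prop) (x : R) : bound P -> P x -> x <= Rsup P.
Proof.
  intros Hb Hx. unfold Rsup.
  destruct (excluded_middle_informative _) as [H|H].
  - destruct (completeness P _ _) as [s [Hs1 Hs2]]; simpl. apply Hs1, Hx.
  - exfalso; apply H; eauto.
Qed.

(** The hypothesis [0 <= c] covers the empty set, where [Rsup] takes its default value 0. *)
Lemma Rsup_le (P : R -> Prop) (c : R) : 0 <= c -> (forall x, P x -> x <= c) -> Rsup P <= c.
Proof.
  intros Hc H. unfold Rsup.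
  destruct (excluded_middle_informative _) as [H'|H']; auto.
  destruct (completeness P _ _) as [s [Hs1 Hs2]]; simpl. apply Hs2; exact H.
Qed.

Lemma Rsup_ge0 (P : R -> Prop) : (forall x, P x -> 0 <= x) -> 0 <= Rsup P.
Proof.
  intros H. unfold Rsup.
  destruct (excluded_middle_informative _) as [[H1 [x Hx]]|H']; [|lra].
  destruct (completeness P _ _) as [s [Hs1 Hs2]]; simpl.
  apply Rle_trans with x; auto.
Qed.

Lemma Rsup_singleton (P : R -> Prop) (l : R) : P l -> (forall x, P x -> x = l) -> Rsup P = l.
Proof.
  intros Hl Hu. unfold Rsup.
  destruct (excluded_middle_informative _) as [H|H].
  - destruct (completeness P _ _) as [s [Hs1 Hs2]]; simpl.
    apply Rle_antisym; [apply Hs2|apply Hs1; auto].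
    intros x Hx; rewrite (Hu x Hx); lra.
  - exfalso; apply H; split; [exists l; intros x Hx; rewrite (Hu x Hx); lra|eauto].
Qed.

Lemma rpow_ge0 (a e : R) : 0 <= rpow a e.
Proof. unfold rpow; destruct (Rlt_dec 0 a); [left; apply exp_pos|lra]. Qed.

Lemma rpow_pos (a e : R) : 0 < a -> 0 < rpow a e.
Proof. intros; unfold rpow; destruct (Rlt_dec 0 a); [apply exp_pos|lra]. Qed.

Lemma rpow_npos (a e : R) : a <= 0 -> rpow a e = 0.
Proof. intros; unfold rpow; destruct (Rlt_dec 0 a); lra. Qed.

Lemma rpow_0 (e : R) : rpow 0 e = 0.
Proof. apply rpow_npos; lra. Qed.

Lemma rpow_lt (a b e : R) : 0 < e -> 0 <= a < b -> rpow a e < rpow b e.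
Proof.
  intros He [[H0|H0] Hab].
  - unfold rpow; destruct (Rlt_dec 0 a), (Rlt_dec 0 b); try lra.
    apply Rlt_Rpower_l; lra.
  - subst a; rewrite rpow_0; apply rpow_pos; lra.
Qed.

Lemma rpow_le (a b e : R) : 0 < e -> a <= b -> rpow a e <= rpow b e.
Proof.
  intros He Hab.
  destruct (Rle_lt_dec a 0). { rewrite rpow_npos by auto; apply rpow_ge0. }
  destruct Hab as [Hab|Hab]; [|subst; lra].
  left; apply rpow_lt; lra.
Qed.

Lemma rpow_1_r (a : R) : 0 <= a -> rpow a 1 = a.
Proof.
  intros [H|H]; [|subst; apply rpow_0].
  unfold rpow; destruct (Rlt_dec 0 a); [apply Rpower_1|]; lra.
Qed.

Lemma rpow_1_l (e : R) : rpow 1 e = 1.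
Proof.
  unfold rpow; destruct (Rlt_dec 0 1); [|lra].
  unfold Rpower; rewrite ln_1, Rmult_0_r; apply exp_0.
Qed.

Lemma rpow_mul (a b e : R) : 0 <= a -> 0 <= b -> rpow (a * b) e = rpow a e * rpow b e.
Proof.
  intros [Ha|Ha] [Hb|Hb]; subst; rewrite ?Rmult_0_l, ?Rmult_0_r, ?rpow_0, ?Rmult_0_l, ?Rmult_0_r; auto.
  unfold rpow; destruct (Rlt_dec 0 a), (Rlt_dec 0 b), (Rlt_dec 0 (a*b)); try lra; try nra.
  symmetry; apply Rpower_mult_distr; lra.
Qed.

Lemma rpow_rpow (a e f : R) : rpow (rpow a e) f = rpow a (e * f).
Proof.
  destruct (Rle_lt_dec a 0). { rewrite !(rpow_npos a), rpow_0; auto. }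
  unfold rpow at 2 3; destruct (Rlt_dec 0 a); [|lra].
  unfold rpow; destruct (Rlt_dec 0 (Rpower a e)).
  - apply Rpower_mult.
  - exfalso; apply n, exp_pos.
Qed.

Lemma rpow_plus (a e f : R) : 0 < a -> rpow a (e + f) = rpow a e * rpow a f.
Proof.
  intros; unfold rpow; destruct (Rlt_dec 0 a); [apply Rpower_plus|lra].
Qed.

Lemma rpow_root (a p : R) : 0 < p -> 0 <= a -> rpow (rpow a p) (/ p) = a.
Proof. intros; rewrite rpow_rpow, Rinv_r, rpow_1_r; lra. Qed.

Lemma root_rpow (a p : R) : 0 < p -> 0 <= a -> rpow (rpow a (/ p)) p = a.
Proof. intros; rewrite rpow_rpow, Rinv_l, rpow_1_r; lra. Qed.

Lemma rpow_le_inv (a b p : R) : 0 < p -> 0 <= b -> rpow a p <= rpow b p -> a <= b.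
Proof.
  intros Hp Hb H. destruct (Rle_lt_dec a b); auto.
  assert (rpow b p < rpow a p) by (apply rpow_lt; lra). lra.
Qed.

(* Weighted AM-GM through [ln x <= x - 1]. *)
Lemma rpow_concave_tangent (s a : R) : 0 <= s -> 0 < a <= 1 -> rpow s a <= 1 + a * (s - 1).
Proof.
  intros [Hs|Hs] Ha.
  2:{ subst; rewrite rpow_0; nra. }
  assert (Hln : forall x, 0 < x -> ln x <= x - 1).
  { intros x Hx. destruct (Rle_lt_dec (ln x) (x - 1)) as [|H]; auto.
    pose proof (exp_ineq1_le (ln x)). rewrite exp_ln in H0; lra. }
  set (m := 1 + a * (s - 1)).
  assert (Hm : 0 < m) by (unfold m; nra).
  unfold rpow; destruct (Rlt_dec 0 s); [|lra].
  unfold Rpower. rewrite <- (exp_ln m) by auto.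
  assert (Hle : a * ln s <= ln m).
  { pose proof (Hln (s / m) (Rdiv_lt_0_compat _ _ Hs Hm)) as H1.
    pose proof (Hln (/ m) (Rinv_0_lt_compat _ Hm)) as H2.
    unfold Rdiv in H1. rewrite ln_mult in H1 by (auto using Rinv_0_lt_compat).
    rewrite ln_Rinv in H1, H2 by auto.
    assert (E : a * (s * / m - 1) + (1 - a) * (/ m - 1) = 0).
    { unfold m; field; unfold m in Hm; lra. }
    nra. }
  destruct Hle as [H|H]; [left; apply exp_increasing; auto|rewrite H; lra].
Qed.

(** The tangent inequality for the concave power [/ p], read at the point [rpow t p]. *)
Lemma rpow_bernoulli (t p : R) : 0 <= t -> 1 <= p -> 1 + p * (t - 1) <= rpow t p.
Proof.
  intros Ht Hp.
  assert (Hi : 0 < / p <= 1).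
  { split; [apply Rinv_0_lt_compat; lra|]. rewrite <- Rinv_1; apply Rinv_le_contravar; lra. }
  pose proof (rpow_concave_tangent (rpow t p) (/ p) (rpow_ge0 _ _) Hi) as H.
  rewrite rpow_root in H by lra.
  apply Rmult_le_compat_l with (r := p) in H; [|lra].
  rewrite Rmult_plus_distr_l, <- Rmult_assoc, Rinv_r in H by lra. lra.
Qed.

(** Both values lie above the tangent at the mean [m], which is Bernoulli after rescaling by [m]; in
    the average the linear terms cancel. *)
Lemma rpow_convex (a b l p : R) : 0 <= a -> 0 <= b -> 0 < l < 1 -> 1 <= p ->
  rpow (l * a + (1 - l) * b) p <= l * rpow a p + (1 - l) * rpow b p.
Proof.
  intros Ha Hb Hl Hp.
  set (m := l * a + (1 - l) * b).
  destruct (Rle_lt_dec m 0) as [Hm|Hm].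
  { rewrite (rpow_npos m) by auto. pose proof (rpow_ge0 a p); pose proof (rpow_ge0 b p); nra. }
  assert (Hx : forall x, 0 <= x -> rpow m p * (1 + p * (x / m - 1)) <= rpow x p).
  { intros x Hx. replace x with (m * (x / m)) at 2 by (field; lra).
    assert (0 <= x / m) by (apply Rle_mult_inv_pos; auto).
    rewrite rpow_mul by lra.
    apply Rmult_le_compat_l; [apply rpow_ge0|apply rpow_bernoulli; auto]. }
  pose proof (Hx a Ha) as H1. pose proof (Hx b Hb) as H2.
  apply Rle_trans with (l * (rpow m p * (1 + p * (a / m - 1))) + (1 - l) * (rpow m p * (1 + p * (b / m - 1)))).
  2: nra.
  apply Req_le.
  replace (l * (rpow m p * (1 + p * (a / m - 1))) + (1 - l) * (rpow m p * (1 + p * (b / m - 1))))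
   with (rpow m p * (1 + p * ((l * a + (1 - l) * b) / m - 1))) by (field; lra).
  fold m. replace (m / m) with 1 by (field; lra). ring.
Qed.

(* Convexity in the homogeneous form from which subadditivity of a [p]-th root follows
   (lemma [subadditive_root]). *)
Lemma rpow_add_le (a b l p : R) : 0 <= a -> 0 <= b -> 0 < l < 1 -> 1 <= p ->
  rpow (a + b) p <= rpow l (1 - p) * rpow a p + rpow (1 - l) (1 - p) * rpow b p.
Proof.
  intros Ha Hb Hl Hp.
  pose proof (rpow_convex (a / l) (b / (1 - l)) l p
    ltac:(apply Rle_mult_inv_pos; lra) ltac:(apply Rle_mult_inv_pos; lra) Hl Hp) as H.
  replace (l * (a / l) + (1 - l) * (b / (1 - l))) with (a + b) in H by (field; lra).
  assert (E : forall x y, 0 <= x -> 0 < y -> rpow y (1 - p) * rpow x p = y * rpow (x / y) p).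
  { intros x y Hx Hy. replace x with (y * (x / y)) at 1 by (field; lra).
    rewrite rpow_mul by (try lra; apply Rle_mult_inv_pos; lra).
    rewrite <- Rmult_assoc, <- rpow_plus by auto.
    replace (1 - p + p) with 1 by ring. rewrite rpow_1_r; lra. }
  rewrite !E by lra. exact H.
Qed.

(** For [mx = a^p] and [my = b^p] the right side is smallest at [l = a / (a + b)], with value
    [(a + b)^p]. For fixed [l] the hypothesis is linear in the powers, so it passes through suprema
    and sums; this yields the triangle inequalities for [nm] and [NA] without Minkowski's
    inequality. *)
Lemma subadditive_root (mz mx my p : R) : 1 <= p -> 0 <= mz -> 0 <= mx -> 0 <= my ->
  (forall l, 0 < l < 1 -> mz <= rpow l (1 - p) * mx + rpow (1 - l) (1 - p) * my) ->
  rpow mz (/ p) <= rpow mx (/ p) + rpow my (/ p).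
Proof.
  intros Hp Hz Hx Hy H.
  set (a := rpow mx (/ p)). set (b := rpow my (/ p)).
  assert (Ea : mx = rpow a p) by (unfold a; rewrite root_rpow; lra).
  assert (Eb : my = rpow b p) by (unfold b; rewrite root_rpow; lra).
  assert (Ha : 0 <= a) by apply rpow_ge0. assert (Hb : 0 <= b) by apply rpow_ge0.
  clearbody a b. subst mx my.
  (* perturb both terms so that [l = a / (a + b)] is admissible *)
  assert (Hpert : forall e, 0 < e -> rpow mz (/ p) <= (a + e) + (b + e)).
  { intros e He. set (a' := a + e). set (b' := b + e).
    assert (Ha' : 0 < a') by (unfold a'; lra). assert (Hb' : 0 < b') by (unfold b'; lra).
    assert (Hl : 0 < a' / (a' + b') < 1).
    { split; [apply Rdiv_lt_0_compat; lra|].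
      apply Rmult_lt_reg_r with (a' + b'); [lra|]. unfold Rdiv; rewrite Rmult_assoc, Rinv_l; lra. }
    specialize (H _ Hl).
    assert (E : forall x, 0 < x -> rpow (x / (a' + b')) (1 - p) * rpow x p
                = x * rpow (a' + b') (p - 1)).
    { intros x Hx0. replace (rpow x p) with (x * rpow (x / (a' + b') * (a' + b')) (p - 1)).
      2:{ replace (x / (a' + b') * (a' + b')) with x by (field; lra).
          rewrite <- (rpow_1_r x) at 1 by lra. rewrite <- rpow_plus by auto. f_equal; ring. }
      assert (0 < x / (a' + b')) by (apply Rdiv_lt_0_compat; lra).
      rewrite rpow_mul by lra.
      replace (rpow (x / (a' + b')) (1 - p) * (x * (rpow (x / (a' + b')) (p - 1) * rpow (a' + b') (p - 1))))
        with ((rpow (x / (a' + b')) (1 - p) * rpow (x / (a' + b')) (p - 1)) * (x * rpow (a' + b') (p - 1))) by ring.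
      rewrite <- rpow_plus by auto. replace (1 - p + (p - 1)) with (0) by ring.
      unfold rpow at 1; destruct (Rlt_dec _ _); [|lra]. rewrite Rpower_O by auto. ring. }
    assert (Hm : mz <= rpow (a' + b') p).
    { eapply Rle_trans; [exact H|].
      apply Rle_trans with (rpow (a' / (a' + b')) (1 - p) * rpow a' p
         + rpow (1 - a' / (a' + b')) (1 - p) * rpow b' p).
      - apply Rplus_le_compat; apply Rmult_le_compat_l; try apply rpow_ge0;
          apply rpow_le; unfold a', b'; lra.
      - replace (1 - a' / (a' + b')) with (b' / (a' + b')) by (field; lra).
        rewrite !E by lra.
        replace p with (1 + (p - 1)) at 3 by ring. rewrite rpow_plus by lra.
        rewrite rpow_1_r; lra. }
    assert (Hq : 0 < / p) by (apply Rinv_0_lt_compat; lra).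
    pose proof (rpow_le _ _ (/ p) Hq Hm) as H2.
    rewrite rpow_root in H2 by lra. exact H2. }
  apply le_epsilon. intros e He. specialize (Hpert (e / 2) ltac:(lra)). lra.
Qed.

Lemma rpow_small (g e : R) : 0 < g -> 0 < e -> exists d, 0 < d <= 1 / 2 /\ rpow d g <= e.
Proof.
  intros Hg He. exists (Rmin (1 / 2) (rpow e (/ g))).
  assert (0 < rpow e (/ g)) by (apply rpow_pos; auto).
  split; [split; [apply Rmin_glb_lt; lra|apply Rmin_l]|].
  apply Rle_trans with (rpow (rpow e (/ g)) g).
  - apply rpow_le; [auto|apply Rmin_r].
  - rewrite root_rpow; lra.
Qed.

Lemma rsum_le (n : nat) (f g : nat -> R) :
  (forall i, (i < n)%nat -> f i <= g i) -> rsum n f <= rsum n g.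
Proof.
  induction n; simpl; intros H; [lra|].
  apply Rplus_le_compat; auto.
Qed.

Lemma rsum_ext (n : nat) (f g : nat -> R) :
  (forall i, (i < n)%nat -> f i = g i) -> rsum n f = rsum n g.
Proof. induction n; simpl; intros H; [lra|]. f_equal; auto. Qed.

Lemma rsum_plus (n : nat) (f g : nat -> R) :
  rsum n (fun i => f i + g i) = rsum n f + rsum n g.
Proof. induction n; simpl; lra. Qed.

Lemma rsum_scal (n : nat) (c : R) (f : nat -> R) :
  rsum n (fun i => c * f i) = c * rsum n f.
Proof. induction n; simpl; lra. Qed.

Lemma rsum_const (n : nat) (c : R) : rsum n (fun _ => c) = INR n * c.
Proof. induction n; simpl rsum; [simpl; lra|]. rewrite IHn, S_INR; lra. Qed.

Lemma rsum_ge0 (n : nat) (f : nat -> R) : (forall i, (i < n)%nat -> 0 <= f i) -> 0 <= rsum n f.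
Proof. induction n; simpl; intros H; [lra|]. apply Rplus_le_le_0_compat; auto. Qed.

Lemma rsum_term (n : nat) (f : nat -> R) (i : nat) :
  (forall j, (j < n)%nat -> 0 <= f j) -> (i < n)%nat -> f i <= rsum n f.
Proof.
  induction n; simpl; intros H Hi; [lia|].
  assert (0 <= rsum n f) by (apply rsum_ge0; auto).
  destruct (Nat.eq_dec i n); [subst; lra|].
  specialize (IHn ltac:(auto) ltac:(lia)). specialize (H n ltac:(lia)). lra.
Qed.

Lemma uniform_index (n : nat) (P : nat -> nat -> Prop) :
  (forall i, (i < n)%nat -> exists N, forall m, (N <= m)%nat -> P i m) ->
  exists N, forall i m, (i < n)%nat -> (N <= m)%nat -> P i m.
Proof.
  induction n; intros H; [exists O; lia|].
  destruct IHn as [N1 H1]; [auto|]. destruct (H n ltac:(lia)) as [N2 H2].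
  exists (Nat.max N1 N2); intros i m Hi Hm.
  destruct (Nat.eq_dec i n); [subst; apply H2; lia|apply H1; lia].
Qed.

Lemma uniform_pos (n : nat) (P : nat -> R -> Prop) :
  (forall i e e', P i e -> 0 < e' <= e -> P i e') ->
  (forall i, (i < n)%nat -> exists e, 0 < e /\ P i e) ->
  exists e, 0 < e /\ forall i, (i < n)%nat -> P i e.
Proof.
  intros Hd. induction n; intros H; [exists 1; split; [lra|lia]|].
  destruct IHn as [e1 [H1 H1']]; [auto|]. destruct (H n ltac:(lia)) as [e2 [H2 H2']].
  exists (Rmin e1 e2).
  assert (0 < Rmin e1 e2) by (apply Rmin_glb_lt; auto).
  split; auto. intros i Hi.
  destruct (Nat.eq_dec i n).
  - subst. apply Hd with e2; auto. split; [auto|apply Rmin_r].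
  - apply Hd with e1; [apply H1'; lia|]. split; [auto|apply Rmin_l].
Qed.

(** * p-convexifications *)

Definition sadd (x y : nat -> R) : nat -> R := fun k => x k + y k.
Definition sscal (c : R) (x : nat -> R) : nat -> R := fun k => c * x k.
Definition tail (N : nat) (x : nat -> R) : nat -> R := fun k => if Nat.ltb k N then 0 else x k.
Definition seg (ab : nat * nat) (x : nat -> R) : nat -> R :=
  fun k => if (Nat.leb (fst ab) k && Nat.ltb k (snd ab))%bool then x k else 0.
Definition ev (n : nat) : nat -> R := fun k => if Nat.eqb k n then 1 else 0.

Definition lsum {A} (f : A -> R) (l : list A) : R := fold_right (fun a acc => f a + acc) 0 l.

(** Gaps are allowed, [lo] being only a lower bound, so that chains can be filtered, clipped and
    concatenated. *)
Fixpoint chain (lo : nat) (l : list (nat * nat)) : Prop :=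
  match l with
  | [] => True
  | ab :: t => (lo <= fst ab)%nat /\ (fst ab < snd ab)%nat /\ chain (snd ab) t
  end.

Ltac seqcase :=
  repeat match goal with
  | |- context [Nat.ltb ?a ?b] => destruct (Nat.ltb_spec a b)
  | |- context [Nat.leb ?a ?b] => destruct (Nat.leb_spec a b)
  | |- context [Nat.eqb ?a ?b] => destruct (Nat.eqb_spec a b)
  end; simpl; subst; try lia.

(* In [bn_low], coordinate [lo] is the integer [lo + 1], whence the bound [S lo]. *)
Record bnorm (b : (nat -> R) -> R) : Prop := {
  bn_ge0 : forall x, c00 x -> 0 <= b x;
  bn_add : forall x y, c00 x -> c00 y -> b (sadd x y) <= b x + b y;
  bn_scal : forall c x, c00 x -> 0 <= c -> b (sscal c x) <= c * b x;
  bn_mono : forall x y, c00 y -> (forall k, Rabs (x k) <= Rabs (y k)) -> b x <= b y;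
  bn_unit : forall n, b (ev n) = 1;
  bn_low : forall x lo l, c00 x -> chain lo l -> (length l <= S lo)%nat ->
    lsum (fun ab => b (seg ab x)) l <= 2 * b x }.

Lemma lsum_le {A} (f g : A -> R) (l : list A) :
  (forall a, In a l -> f a <= g a) -> lsum f l <= lsum g l.
Proof.
  induction l; simpl; intros H; [lra|]. apply Rplus_le_compat; auto.
Qed.

Lemma lsum_app {A} (f : A -> R) (l l' : list A) : lsum f (l ++ l') = lsum f l + lsum f l'.
Proof. induction l; simpl; [lra|]. rewrite IHl; lra. Qed.

Lemma lsum_ge0 {A} (f : A -> R) (l : list A) : (forall a, In a l -> 0 <= f a) -> 0 <= lsum f l.
Proof. induction l; simpl; intros H; [lra|]. apply Rplus_le_le_0_compat; auto. Qed.

Lemma lsum_plus {A} (f g : A -> R) (l : list A) : lsum (fun a => f a + g a) l = lsum f l + lsum g l.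
Proof. induction l; simpl; lra. Qed.

Lemma lsum_scal {A} (f : A -> R) c (l : list A) : lsum (fun a => c * f a) l = c * lsum f l.
Proof. induction l; simpl; lra. Qed.

Lemma lsum_lower {A} (f : A -> R) c (l : list A) :
  (forall a, In a l -> c <= f a) -> INR (length l) * c <= lsum f l.
Proof.
  induction l; intros H; [simpl; lra|].
  simpl length; rewrite S_INR; simpl lsum.
  specialize (IHl ltac:(intros; apply H; right; auto)). specialize (H a ltac:(left; auto)). lra.
Qed.

Lemma chain_weaken lo lo' l : (lo' <= lo)%nat -> chain lo l -> chain lo' l.
Proof. destruct l; simpl; intuition lia. Qed.

Lemma c00_trunc N x : c00 (trunc N x).
Proof. exists N; intros k Hk; unfold trunc; seqcase; auto. Qed.
Lemma c00_ev n : c00 (ev n).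
Proof. exists (S n); intros k Hk; unfold ev; seqcase; auto. Qed.
Lemma c00_sscal c x : c00 x -> c00 (sscal c x).
Proof. intros [N H]; exists N; intros k Hk; unfold sscal; rewrite H; [ring|auto]. Qed.
Lemma c00_sadd x y : c00 x -> c00 y -> c00 (sadd x y).
Proof.
  intros [N H] [M H']; exists (Nat.max N M); intros k Hk; unfold sadd; rewrite H, H'; [ring|lia|lia].
Qed.
#[local] Hint Resolve c00_trunc c00_ev c00_sscal c00_sadd : core.

(** Boundedness of the truncations replaces the Cauchy condition of a completion; the two agree by
    bounded completeness ([nmp_tail_small]). *)
Definition mem (b : (nat -> R) -> R) (p : R) (x : nat -> R) : Prop :=
  exists C, forall N, b (trunc N (pw p x)) <= C.
(** The [p]-th power of the norm has its own name because the upper and lower block estimates are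
    linear in it. *)
Definition nmp (b : (nat -> R) -> R) (p : R) (x : nat -> R) : R :=
  Rsup (fun r => exists N, r = b (trunc N (pw p x))).
Definition nm (b : (nat -> R) -> R) (p : R) (x : nat -> R) : R := rroot (nmp b p x) p.

Lemma pw_ge0 p x k : 0 <= pw p x k.
Proof. apply rpow_ge0. Qed.

Lemma trunc_pw_ge0 p x N k : 0 <= trunc N (pw p x) k.
Proof. unfold trunc; seqcase; [apply rpow_ge0|lra]. Qed.

Lemma pw_zero p x k : x k = 0 -> pw p x k = 0.
Proof. intros H; unfold pw; rewrite H, Rabs_R0; apply rpow_0. Qed.

Section PConvexification.
Context {b : (nat -> R) -> R} (Hb : bnorm b) {p : R} (Hp : 1 <= p).

Lemma bn_trunc_ge0 N x : 0 <= b (trunc N x).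
Proof. apply (bn_ge0 b Hb); auto. Qed.

Lemma bn_mono_nonneg x y : c00 y -> (forall k, 0 <= x k <= y k) -> b x <= b y.
Proof.
  intros Hy H; apply (bn_mono b Hb); auto. intros k. specialize (H k).
  rewrite !Rabs_pos_eq; lra.
Qed.

Lemma nmp_ge0 x : 0 <= nmp b p x.
Proof. apply Rsup_ge0. intros r [N ->]. apply bn_trunc_ge0. Qed.

Lemma nm_ge0 x : 0 <= nm b p x.
Proof. apply rpow_ge0. Qed.

Lemma nmp_ub x N : mem b p x -> b (trunc N (pw p x)) <= nmp b p x.
Proof.
  intros [C H]. apply Rsup_ub; eauto. exists C. intros r [M ->]; auto.
Qed.

Lemma nmp_le x C : 0 <= C -> (forall N, b (trunc N (pw p x)) <= C) -> mem b p x /\ nmp b p x <= C.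
Proof.
  intros HC H; split; [exists C; auto|]. apply Rsup_le; auto. intros r [N ->]; auto.
Qed.

Lemma nm_pow x : rpow (nm b p x) p = nmp b p x.
Proof. apply root_rpow; [lra|apply nmp_ge0]. Qed.

Lemma nm_le_of_nmp x C : 0 <= C -> nmp b p x <= rpow C p -> nm b p x <= C.
Proof.
  intros HC H. apply rpow_le_inv with p; [lra|auto|]. rewrite nm_pow; auto.
Qed.

Lemma nmp_mono x y : mem b p y -> (forall k, Rabs (x k) <= Rabs (y k)) ->
  mem b p x /\ nmp b p x <= nmp b p y.
Proof.
  intros Hy H. apply nmp_le; [apply nmp_ge0|]. intros N.
  eapply Rle_trans; [|apply (nmp_ub y N); auto].
  apply bn_mono_nonneg; auto. intros k; split; [apply trunc_pw_ge0|].
  unfold trunc; seqcase; [|lra]. apply rpow_le; [lra|auto].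
Qed.

Lemma nm_mono x y : mem b p y -> (forall k, Rabs (x k) <= Rabs (y k)) ->
  mem b p x /\ nm b p x <= nm b p y.
Proof.
  intros Hy H. destruct (nmp_mono x y Hy H) as [H1 H2]; split; auto.
  apply rpow_le; auto. apply Rinv_0_lt_compat; lra.
Qed.

Lemma nmp_ext x y : (forall k, Rabs (x k) = Rabs (y k)) -> nmp b p x = nmp b p y.
Proof.
  intros H. unfold nmp. f_equal. apply functional_extensionality; intros r.
  replace (pw p x) with (pw p y); auto. apply functional_extensionality; intros k.
  unfold pw; rewrite H; auto.
Qed.

Lemma nm_ext x y : (forall k, Rabs (x k) = Rabs (y k)) -> nm b p x = nm b p y.
Proof. intros H; unfold nm; rewrite (nmp_ext x y H); auto. Qed.

Lemma nmp_fin x N : (forall k, (N <= k)%nat -> x k = 0) ->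
  mem b p x /\ nmp b p x = b (pw p x).
Proof.
  intros H.
  assert (Hc : c00 (pw p x)) by (exists N; intros k Hk; apply pw_zero; auto).
  assert (H1 : forall M, b (trunc M (pw p x)) <= b (pw p x)).
  { intros M. apply bn_mono_nonneg; auto. intros k; split; [apply trunc_pw_ge0|].
    unfold trunc; seqcase; [lra|apply pw_ge0]. }
  destruct (nmp_le x (b (pw p x)) (bn_ge0 b Hb _ Hc) H1) as [Hm Hle].
  split; auto. apply Rle_antisym; auto.
  eapply Rle_trans; [|apply (nmp_ub x N); auto].
  apply bn_mono_nonneg; auto. intros k; split; [apply pw_ge0|].
  unfold trunc; seqcase; [lra|]. rewrite pw_zero; [lra|auto].
Qed.

Lemma mem_fin x N : (forall k, (N <= k)%nat -> x k = 0) -> mem b p x.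
Proof. intros H; apply (nmp_fin x N H). Qed.

Lemma mem_trunc N x : mem b p (trunc N x).
Proof. apply (mem_fin _ N). intros k Hk; unfold trunc; seqcase; auto. Qed.

Lemma mem_seg ab x : mem b p (seg ab x).
Proof. apply (mem_fin _ (snd ab)). intros k Hk; unfold seg; seqcase; auto. Qed.

Lemma mem_ev n : mem b p (ev n).
Proof. apply (mem_fin _ (S n)). intros k Hk; unfold ev; seqcase; auto. Qed.

Lemma nmp_scal_le c x : mem b p x -> mem b p (sscal c x) /\ nmp b p (sscal c x) <= rpow (Rabs c) p * nmp b p x.
Proof.
  intros Hx. apply nmp_le.
  { apply Rmult_le_pos; [apply rpow_ge0|apply nmp_ge0]. }
  intros N. apply Rle_trans with (b (sscal (rpow (Rabs c) p) (trunc N (pw p x)))).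
  - apply bn_mono_nonneg; auto. intros k; split; [apply trunc_pw_ge0|].
    unfold sscal, trunc; seqcase; [|lra].
    unfold pw. rewrite Rabs_mult, rpow_mul by apply Rabs_pos; lra.
  - eapply Rle_trans; [apply (bn_scal b Hb); auto; apply rpow_ge0|].
    apply Rmult_le_compat_l; [apply rpow_ge0|apply nmp_ub; auto].
Qed.

Lemma nm_scal_le c x : mem b p x -> mem b p (sscal c x) /\ nm b p (sscal c x) <= Rabs c * nm b p x.
Proof.
  intros Hx. destruct (nmp_scal_le c x Hx) as [H1 H2]; split; auto.
  apply nm_le_of_nmp; [apply Rmult_le_pos; [apply Rabs_pos|apply nm_ge0]|].
  rewrite rpow_mul, nm_pow; auto; [apply Rabs_pos|apply nm_ge0].
Qed.

Lemma nm_scal c x : mem b p x -> nm b p (sscal c x) = Rabs c * nm b p x.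
Proof.
  intros Hx. destruct (nm_scal_le c x Hx) as [H1 H2]. apply Rle_antisym; auto.
  destruct (Req_dec c 0) as [->|Hc]; [rewrite Rabs_R0, Rmult_0_l; apply nm_ge0|].
  destruct (nm_scal_le (/ c) _ H1) as [H3 H4].
  rewrite (nm_ext (sscal (/ c) (sscal c x)) x) in H4.
  2:{ intros k; unfold sscal; f_equal; field; auto. }
  rewrite Rabs_inv in H4. assert (0 < Rabs c) by (apply Rabs_pos_lt; auto).
  apply Rmult_le_compat_l with (r := Rabs c) in H4; [|lra].
  rewrite <- Rmult_assoc, Rinv_r in H4; lra.
Qed.

(** The weight [l] is fixed before the truncation index, so the pointwise bound survives the
    supremum; [subadditive_root] optimises [l] afterwards. *)
Lemma nmp_add l x y : mem b p x -> mem b p y -> 0 < l < 1 ->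
  mem b p (sadd x y) /\
  nmp b p (sadd x y) <= rpow l (1 - p) * nmp b p x + rpow (1 - l) (1 - p) * nmp b p y.
Proof.
  intros Hx Hy Hl.
  assert (G1 := rpow_ge0 l (1 - p)). assert (G2 := rpow_ge0 (1 - l) (1 - p)).
  apply nmp_le.
  { apply Rplus_le_le_0_compat; apply Rmult_le_pos; auto; apply nmp_ge0. }
  intros N.
  apply Rle_trans with (b (sadd (sscal (rpow l (1 - p)) (trunc N (pw p x)))
                              (sscal (rpow (1 - l) (1 - p)) (trunc N (pw p y))))).
  - apply bn_mono_nonneg; auto. intros k; split; [apply trunc_pw_ge0|].
    unfold sadd, sscal, trunc; seqcase; [|lra].
    unfold pw. eapply Rle_trans; [apply rpow_le; [lra|apply Rabs_triang]|].
    apply rpow_add_le; auto; apply Rabs_pos.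
  - eapply Rle_trans; [apply (bn_add b Hb); auto|].
    apply Rplus_le_compat; (eapply Rle_trans; [apply (bn_scal b Hb); auto|]);
      apply Rmult_le_compat_l; auto; apply nmp_ub; auto.
Qed.

Lemma nm_add x y : mem b p x -> mem b p y ->
  mem b p (sadd x y) /\ nm b p (sadd x y) <= nm b p x + nm b p y.
Proof.
  intros Hx Hy. split; [apply (nmp_add (1 / 2)); auto; lra|].
  apply subadditive_root; auto using nmp_ge0.
  intros l Hl; apply nmp_add; auto.
Qed.

Lemma nm_sub x y : mem b p x -> mem b p y ->
  mem b p (seq_sub x y) /\ nm b p (seq_sub x y) <= nm b p x + nm b p y.
Proof.
  intros Hx Hy.
  destruct (nm_scal_le (-1) y Hy) as [H1 H2].
  destruct (nm_add x _ Hx H1) as [H3 H4].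
  replace (sadd x (sscal (-1) y)) with (seq_sub x y) in *
    by (apply functional_extensionality; intros k; unfold sadd, sscal, seq_sub; ring).
  split; auto. rewrite Rabs_left in H2; lra.
Qed.

(** On disjoint supports [|x + y|^p = |x|^p + |y|^p] pointwise, whence the constant 1. *)
Lemma nmp_disjoint x y : mem b p x -> mem b p y -> (forall k, x k = 0 \/ y k = 0) ->
  nmp b p (sadd x y) <= nmp b p x + nmp b p y.
Proof.
  intros Hx Hy H. apply nmp_le; [apply Rplus_le_le_0_compat; apply nmp_ge0|].
  intros N. apply Rle_trans with (b (sadd (trunc N (pw p x)) (trunc N (pw p y)))).
  - apply bn_mono_nonneg; auto. intros k; split; [apply trunc_pw_ge0|].
    unfold sadd, trunc; seqcase; [|lra]. unfold pw.
    destruct (H k) as [E|E]; rewrite E, ?Rplus_0_l, ?Rplus_0_r, Rabs_R0, rpow_0; lra.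
  - eapply Rle_trans; [apply (bn_add b Hb); auto|].
    apply Rplus_le_compat; apply nmp_ub; auto.
Qed.

(** The norm is by construction a supremum over truncations. This is what keeps bounded
    coordinatewise limits inside the space. *)
Lemma nm_fatou x C : (forall N, nm b p (trunc N x) <= C) -> mem b p x /\ nm b p x <= C.
Proof.
  intros H. assert (HC : 0 <= C) by (eapply Rle_trans; [apply nm_ge0|apply (H O)]).
  destruct (nmp_le x (rpow C p)) as [H1 H2]; [apply rpow_ge0| |].
  - intros N. destruct (nmp_fin (trunc N x) N) as [_ E].
    { intros k Hk; unfold trunc; seqcase; auto. }
    replace (trunc N (pw p x)) with (pw p (trunc N x)).
    2:{ apply functional_extensionality; intros k; unfold pw, trunc; seqcase;
          [reflexivity|rewrite Rabs_R0; apply rpow_0]. }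
    rewrite <- E, <- nm_pow. apply rpow_le; [lra|auto].
  - split; auto. apply nm_le_of_nmp; auto.
Qed.

Lemma nm_ev n : nm b p (ev n) = 1.
Proof.
  unfold nm. destruct (nmp_fin (ev n) (S n)) as [_ E].
  { intros k Hk; unfold ev; seqcase; auto. }
  rewrite E. replace (pw p (ev n)) with (ev n); [rewrite (bn_unit b Hb); apply rpow_1_l|].
  apply functional_extensionality; intros k; unfold pw, ev; seqcase.
  - rewrite Rabs_R1, rpow_1_l; auto.
  - rewrite Rabs_R0, rpow_0; auto.
Qed.

Lemma nm_coord x k : mem b p x -> Rabs (x k) <= nm b p x.
Proof.
  intros Hx. destruct (nm_mono (sscal (x k) (ev k)) x Hx) as [H1 H2].
  - intros j; unfold sscal, ev; seqcase; rewrite ?Rmult_1_r, ?Rmult_0_r, ?Rabs_R0; [lra|apply Rabs_pos].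
  - rewrite nm_scal, nm_ev in H2 by apply mem_ev. lra.
Qed.

(** A crude bound that turns smallness of finitely many coordinates into smallness in norm. *)
Lemma nm_trunc_le N x : nm b p (trunc N x) <= rsum N (fun k => Rabs (x k)).
Proof.
  induction N; simpl.
  - replace (trunc 0 x) with (sscal 0 (ev 0))
      by (apply functional_extensionality; intros k; unfold trunc, sscal; seqcase; ring).
    rewrite nm_scal, Rabs_R0 by apply mem_ev; lra.
  - replace (trunc (S N) x) with (sadd (trunc N x) (sscal (x N) (ev N))).
    2:{ apply functional_extensionality; intros k; unfold trunc, sadd, sscal, ev; seqcase; ring. }
    destruct (nm_scal_le (x N) (ev N) (mem_ev N)) as [H1 H2].
    destruct (nm_add (trunc N x) _ (mem_trunc N x) H1) as [_ H3].
    rewrite nm_ev in H2. lra.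
Qed.

Lemma nmp_low x lo l : mem b p x -> chain lo l -> (length l <= S lo)%nat ->
  lsum (fun ab => nmp b p (seg ab x)) l <= 2 * nmp b p x.
Proof.
  intros Hx Hc Hl.
  assert (HM : exists M, forall ab, In ab l -> (snd ab <= M)%nat).
  { clear. induction l as [|ab l [M HM]]; [exists O; simpl; tauto|].
    exists (Nat.max (snd ab) M). intros cd [->|H]; [lia|]. specialize (HM _ H); lia. }
  destruct HM as [M HM].
  apply Rle_trans with (lsum (fun ab => b (seg ab (trunc M (pw p x)))) l).
  - apply lsum_le. intros ab Hab. specialize (HM _ Hab).
    destruct (nmp_fin (seg ab x) (snd ab)) as [_ E].
    { intros k Hk; unfold seg; seqcase; auto. }
    rewrite E. apply bn_mono_nonneg.
    { exists (snd ab); intros k Hk; unfold seg; seqcase; auto. }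
    intros k; split; [apply pw_ge0|].
    unfold seg, trunc, pw; seqcase; rewrite ?Rabs_R0, ?rpow_0; lra.
  - eapply Rle_trans; [apply (bn_low b Hb _ lo); auto|].
    apply Rmult_le_compat_l; [lra|apply nmp_ub; auto].
Qed.

Lemma mem_tail N x : mem b p x -> mem b p (tail N x).
Proof.
  intros H; apply (nmp_mono _ x H). intros k; unfold tail; seqcase; [|lra].
  rewrite Rabs_R0; apply Rabs_pos.
Qed.

(* A nonvanishing tail would contain arbitrarily many successive blocks of norm bounded below,
   against the lower estimate. *)
Lemma nmp_tail_small x e : mem b p x -> 0 < e -> exists N, nmp b p (tail N x) <= e.
Proof.
  intros Hx He. apply NNPP; intros Hn.
  assert (Hb1 : forall N, exists M, (N < M)%nat /\ e <= nmp b p (seg (N, M) x)).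
  { intros N. apply NNPP; intros Hno. apply Hn; exists N.
    apply (nmp_le _ e); [lra|]. intros M.
    apply Rnot_lt_le; intros Hlt. apply Hno.
    assert (HK : exists K, (M <= K /\ N < K)%nat) by (exists (Nat.max M (S N)); lia).
    destruct HK as [K [HK1 HK2]]. exists K; split; auto.
    destruct (nmp_fin (seg (N, K) x) K) as [_ E].
    { intros k Hk; unfold seg; simpl; seqcase; auto. }
    rewrite E. left; eapply Rlt_le_trans; [exact Hlt|].
    apply bn_mono_nonneg.
    { exists K; intros k Hk; apply pw_zero; unfold seg; simpl; seqcase; auto. }
    intros k; split; [apply trunc_pw_ge0|].
    unfold trunc, pw, tail, seg; simpl; seqcase; rewrite ?Rabs_R0, ?rpow_0; try lra; apply rpow_ge0. }
  assert (Hch : forall n lo, exists l, chain lo l /\ length l = n /\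
            forall ab, In ab l -> e <= nmp b p (seg ab x)).
  { induction n; intros lo; [exists []; simpl; tauto|].
    destruct (Hb1 lo) as [M [HM1 HM2]]. destruct (IHn M) as [l [H1 [H2 H3]]].
    exists ((lo, M) :: l); simpl; repeat split; auto.
    intros ab [<-|Hab]; auto. }
  destruct (INR_unbounded (2 * nmp b p x / e)) as [n Hnn].
  (* The [n] blocks start at coordinate [n], which makes them admissible. *)
  destruct (Hch n n) as [l [H1 [H2 H3]]].
  pose proof (nmp_low x n l Hx H1 ltac:(lia)) as H4.
  pose proof (lsum_lower _ e l H3) as H5. rewrite H2 in H5.
  apply Rmult_lt_compat_r with (r := e) in Hnn; auto.
  unfold Rdiv in Hnn; rewrite Rmult_assoc, Rinv_l in Hnn; lra.
Qed.

Lemma nm_tail_small x e : mem b p x -> 0 < e ->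
  exists N, forall m, (N <= m)%nat -> nm b p (tail m x) <= e.
Proof.
  intros Hx He. destruct (nmp_tail_small x (rpow e p) Hx (rpow_pos _ _ He)) as [N HN].
  exists N; intros m Hm.
  apply Rle_trans with (nm b p (tail N x)).
  - apply nm_mono; [apply mem_tail; auto|]. intros k; unfold tail; seqcase; rewrite ?Rabs_R0; try lra.
    apply Rabs_pos.
  - apply nm_le_of_nmp; lra.
Qed.

End PConvexification.

(** * Lower r-estimates *)

(** Every interval has at least one point, so each dropped interval pushes the start of the rest by
    at least 1. *)
Lemma chain_drop lo l1 l2 : chain lo (l1 ++ l2) -> chain (lo + length l1) l2.
Proof.
  revert lo; induction l1 as [|ab l1 IH]; simpl; intros lo H.
  - rewrite Nat.add_0_r; auto.
  - destruct H as [H1 [H2 H3]]. apply IH in H3. eapply chain_weaken; [|exact H3]. lia.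
Qed.

Lemma chain_filter f lo l : chain lo l -> chain lo (filter f l).
Proof.
  revert lo; induction l as [|ab l IH]; simpl; intros lo H; auto.
  destruct H as [H1 [H2 H3]]. destruct (f ab); simpl.
  - auto.
  - apply IH. eapply chain_weaken; [|exact H3]; lia.
Qed.

Lemma chain_app lo N l1 l2 : (lo <= N)%nat -> chain lo l1 -> (forall ab, In ab l1 -> (snd ab <= N)%nat) ->
  chain N l2 -> chain lo (l1 ++ l2).
Proof.
  revert lo; induction l1 as [|ab l IH]; simpl; intros lo Hlo H1 H2 H3.
  - eapply chain_weaken; eauto.
  - destruct H1 as [H4 [H5 H6]]; repeat split; auto.
Qed.

(* For [r > p], the r-th power of an equivalent norm which is exactly r-superadditive on
   successive vectors. *)
Definition Mr (b : (nat -> R) -> R) (p r : R) (x : nat -> R) : R :=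
  Rsup (fun v => exists l, chain 0 l /\ v = lsum (fun ab => rpow (nm b p (seg ab x)) r) l).

Section LowerEstimate.
Context {b : (nat -> R) -> R} (Hb : bnorm b) {p : R} (Hp : 1 <= p).

Lemma nmp_seg_le ab x : mem b p x -> nmp b p (seg ab x) <= nmp b p x.
Proof.
  intros Hx; apply (nmp_mono Hb Hp _ x Hx). intros k; unfold seg; seqcase; rewrite ?Rabs_R0; try lra;
  apply Rabs_pos.
Qed.

(* Only the second half of the family is admissible, but it contains half of the blocks. *)
Lemma chain_count x c l : mem b p x -> 0 <= c -> chain 0 l ->
  (forall ab, In ab l -> c <= nmp b p (seg ab x)) -> INR (length l) * c <= 4 * nmp b p x.
Proof.
  intros Hx Hc Hl H. set (n := length l). set (h := Nat.div n 2).
  assert (Hh : (2 * h <= n < 2 * h + 2)%nat).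
  { unfold h. pose proof (Nat.div_mod_eq n 2). pose proof (Nat.mod_upper_bound n 2). lia. }
  rewrite <- (firstn_skipn h l) in Hl. apply chain_drop in Hl.
  rewrite length_firstn, Nat.min_l in Hl by (fold n; lia).
  assert (El : length (skipn h l) = (n - h)%nat) by apply length_skipn.
  pose proof (nmp_low Hb x _ (skipn h l) Hx Hl ltac:(simpl; lia)) as H1.
  pose proof (lsum_lower (fun ab => nmp b p (seg ab x)) c (skipn h l)) as H2.
  specialize (H2 ltac:(intros ab Hab; apply H; rewrite <- (firstn_skipn h l); apply in_or_app; auto)).
  rewrite El in H2.
  assert (H3 : INR n <= 2 * INR (n - h)).
  { rewrite <- (Rmult_1_l (INR n)). change 2 with (INR 2). rewrite Rmult_1_l, <- mult_INR. apply le_INR; lia. }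
  nra.
Qed.

Context {r : R} (Hr : p < r).

(** The sum over [s] of [8 * 2^s] blocks, each contributing at most [(2^-s)^(r/p)]. *)
Definition lower_const : R := 8 / (1 - 2 * rpow (1 / 2) (/ p * r)).

(** The ratio [2^(1 - r/p)] of the dyadic series is below 1 because [p < r]. *)
Lemma lower_ratio : 0 <= 2 * rpow (1 / 2) (/ p * r) < 1.
Proof.
  assert (H1 : 1 < / p * r).
  { apply Rmult_lt_reg_l with p; [lra|]. rewrite <- Rmult_assoc, Rinv_r; lra. }
  split; [pose proof (rpow_ge0 (1 / 2) (/ p * r)); lra|].
  replace (/ p * r) with (1 + (/ p * r - 1)) by ring. rewrite rpow_plus, rpow_1_r by lra.
  assert (rpow (1 / 2) (/ p * r - 1) < rpow 1 (/ p * r - 1)) by (apply rpow_lt; lra).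
  rewrite rpow_1_l in H. lra.
Qed.

Lemma lower_const_pos : 0 < lower_const.
Proof. pose proof lower_ratio. apply Rdiv_lt_0_compat; lra. Qed.

(* Dyadic summation: at most [8 * 2^s] blocks exceed level [2^-(s+1)]. *)
Lemma chain_sum_dyadic x l s : mem b p x -> 0 < nmp b p x -> chain 0 l ->
  lsum (fun ab => if Rlt_dec (nmp b p x * (1 / 2) ^ s) (nmp b p (seg ab x))
                  then rpow (nmp b p (seg ab x)) (/ p * r) else 0) l
  <= rpow (nmp b p x) (/ p * r) * (lower_const * (1 - (2 * rpow (1 / 2) (/ p * r)) ^ s)).
Proof.
  intros Hx HB Hl. pose proof lower_ratio as Ht. unfold lower_const.
  set (B := nmp b p x) in *. set (rho := / p * r) in *.
  assert (Hrho : 0 < rho).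
  { unfold rho; apply Rmult_lt_0_compat; [apply Rinv_0_lt_compat|]; lra. }
  set (q := rpow (1 / 2) rho) in *.
  induction s.
  (* At level 0 every term vanishes, since no block exceeds the whole vector. *)
  - simpl pow. rewrite Rmult_1_r.
    replace (rpow B rho * (8 / (1 - 2 * q) * (1 - 1))) with (0 * lsum (fun _ => 0) l) by lra.
    rewrite <- lsum_scal. apply lsum_le. intros ab Hab.
    pose proof (nmp_seg_le ab x Hx). fold B in H. destruct (Rlt_dec _ _); lra.
  - set (f := fun ab => if Rlt_dec (B * (1 / 2) ^ S s) (nmp b p (seg ab x)) then true else false).
    apply Rle_trans with
      (lsum (fun ab => if Rlt_dec (B * (1 / 2) ^ s) (nmp b p (seg ab x))
                  then rpow (nmp b p (seg ab x)) rho else 0) l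
       + rpow (B * (1 / 2) ^ s) rho * INR (length (filter f l))).
    { clear IHs Hl. induction l as [|ab l IH]; simpl; [lra|].
      assert (Hpos := rpow_ge0 (B * (1 / 2) ^ s) rho).
      unfold f at 1. simpl pow.
      assert (Hhalf : B * (1 / 2 * (1 / 2) ^ s) <= B * (1 / 2) ^ s).
      { apply Rmult_le_compat_l; [lra|]. pose proof (pow_lt (1 / 2) s ltac:(lra)). lra. }
      simpl pow in IH.
      destruct (Rlt_dec (B * (1 / 2 * (1 / 2) ^ s)) (nmp b p (seg ab x)));
      destruct (Rlt_dec (B * (1 / 2) ^ s) (nmp b p (seg ab x))); simpl length; rewrite ?S_INR; try lra.
      assert (rpow (nmp b p (seg ab x)) rho <= rpow (B * (1 / 2) ^ s) rho) by (apply rpow_le; lra).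
      lra. }
    assert (Hcnt : INR (length (filter f l)) <= 8 * 2 ^ s).
    { assert (Hpow : 0 < B * (1 / 2) ^ S s) by (apply Rmult_lt_0_compat; [auto|apply pow_lt; lra]).
      pose proof (chain_count x (B * (1 / 2) ^ S s) (filter f l) Hx ltac:(lra)
        (chain_filter f 0 l Hl)) as H.
      specialize (H ltac:(intros ab Hab; apply filter_In in Hab; destruct Hab as [_ Hab];
         unfold f in Hab; destruct (Rlt_dec _ _); [lra|discriminate])).
      fold B in H.
      apply Rmult_le_reg_r with (B * (1 / 2) ^ S s); auto.
      eapply Rle_trans; [exact H|]. apply Req_le.
      simpl pow. replace (8 * 2 ^ s * (B * (1 / 2 * (1 / 2) ^ s))) with (4 * B * (2 ^ s * (1 / 2) ^ s)) by field.
      rewrite <- Rpow_mult_distr. replace (2 * (1 / 2)) with 1 by field. rewrite pow1; ring. }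
    assert (Hpw : rpow (B * (1 / 2) ^ s) rho = rpow B rho * q ^ s).
    { rewrite rpow_mul; [|lra|apply pow_le; lra]. f_equal.
      clear. induction s; simpl; [apply rpow_1_l|]. rewrite rpow_mul, IHs; auto; [lra|apply pow_le; lra]. }
    rewrite Hpw.
    assert (HBr := rpow_ge0 B rho). assert (Hq : 0 <= q) by lra.
    assert (Hqs : 0 <= q ^ s) by (apply pow_le; auto).
    apply Rle_trans with (rpow B rho * (8 / (1 - 2 * q) * (1 - (2 * q) ^ s)) + rpow B rho * q ^ s * (8 * 2 ^ s)).
    { apply Rplus_le_compat; auto. apply Rmult_le_compat_l; auto. apply Rmult_le_pos; auto. }
    apply Req_le. simpl pow. rewrite !Rpow_mult_distr. field. lra.
Qed.

(** A finite chain lies above some dyadic level, apart from blocks of norm zero, so one partial sum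
    of [chain_sum_dyadic] already contains everything. *)
Lemma chain_sum_le x l : mem b p x -> chain 0 l ->
  lsum (fun ab => rpow (nm b p (seg ab x)) r) l <= lower_const * rpow (nm b p x) r.
Proof.
  intros Hx Hl.
  assert (E : forall y, rpow (nm b p y) r = rpow (nmp b p y) (/ p * r)).
  { intros y; unfold nm, rroot; apply rpow_rpow. }
  rewrite E.
  apply Rle_trans with (lsum (fun ab => rpow (nmp b p (seg ab x)) (/ p * r)) l).
  { apply lsum_le; intros; rewrite E; lra. }
  assert (Hrho : 0 < / p * r).
  { apply Rmult_lt_0_compat; [apply Rinv_0_lt_compat|]; lra. }
  pose proof lower_const_pos as HC.
  destruct (Rle_lt_dec (nmp b p x) 0) as [H0|HB].
  { apply Rle_trans with (lsum (fun _ => 0 * 0) l).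
    - apply lsum_le. intros ab _. rewrite rpow_npos; [lra|]. pose proof (nmp_seg_le ab x Hx); lra.
    - rewrite lsum_scal. pose proof (rpow_ge0 (nmp b p x) (/ p * r)). nra. }
  assert (Hs : exists s0, forall s, (s0 <= s)%nat -> forall ab, In ab l -> 0 < nmp b p (seg ab x) ->
              nmp b p x * (1 / 2) ^ s < nmp b p (seg ab x)).
  { clear Hl. induction l as [|ab l [s1 H1]]; [exists O; simpl; tauto|].
    destruct (Rle_lt_dec (nmp b p (seg ab x)) 0) as [Hz|Hz].
    - exists s1; intros s Hs cd [<-|Hcd] Hpos; [lra|auto].
    - destruct (pow_lt_1_zero (1 / 2) ltac:(rewrite Rabs_pos_eq; lra)
        (nmp b p (seg ab x) / nmp b p x) ltac:(apply Rdiv_lt_0_compat; lra)) as [s2 H2].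
      exists (Nat.max s1 s2); intros s Hs cd [<-|Hcd] Hpos; [|apply H1; auto; lia].
      specialize (H2 s ltac:(lia)). rewrite Rabs_pos_eq in H2 by (apply pow_le; lra).
      apply Rmult_lt_compat_l with (r := nmp b p x) in H2; auto.
      replace (nmp b p x * (nmp b p (seg ab x) / nmp b p x)) with (nmp b p (seg ab x)) in H2; auto.
      field; lra. }
  destruct Hs as [s Hs]. specialize (Hs s (Nat.le_refl _)).
  apply Rle_trans with (rpow (nmp b p x) (/ p * r) * (lower_const * (1 - (2 * rpow (1 / 2) (/ p * r)) ^ s))).
  - eapply Rle_trans; [|apply (chain_sum_dyadic x l s Hx HB Hl)].
    apply lsum_le. intros ab Hab. destruct (Rlt_dec _ _); [lra|].
    destruct (Rle_lt_dec (nmp b p (seg ab x)) 0); [rewrite rpow_npos; lra|].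
    exfalso; auto.
  - pose proof lower_ratio.
    assert (0 <= (2 * rpow (1 / 2) (/ p * r)) ^ s) by (apply pow_le; lra).
    rewrite (Rmult_comm lower_const (rpow _ _)). apply Rmult_le_compat_l; [apply rpow_ge0|]. nra.
Qed.

Lemma Mr_ub x l : mem b p x -> chain 0 l ->
  lsum (fun ab => rpow (nm b p (seg ab x)) r) l <= Mr b p r x.
Proof.
  intros Hx Hl. apply Rsup_ub; eauto.
  exists (lower_const * rpow (nm b p x) r). intros v [l' [H ->]]. apply chain_sum_le; auto.
Qed.

Lemma Mr_ge0 x : 0 <= Mr b p r x.
Proof.
  apply Rsup_ge0. intros v [l [_ ->]]. apply lsum_ge0; intros; apply rpow_ge0.
Qed.

Lemma Mr_le_nm x : mem b p x -> Mr b p r x <= lower_const * rpow (nm b p x) r.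
Proof.
  intros Hx. apply Rsup_le.
  - apply Rmult_le_pos; [left; apply lower_const_pos|apply rpow_ge0].
  - intros v [l [Hl ->]]; apply chain_sum_le; auto.
Qed.

Lemma nm_le_Mr x : mem b p x -> nm b p x <= rpow (Mr b p r x) (/ r).
Proof.
  (* A one-interval chain sees the truncation. Truncation at 0 is treated apart, because the
     intervals of a chain are nonempty. *)
  intros Hx. apply (nm_fatou Hb Hp). intros [|N].
  - pose proof (nm_trunc_le Hb Hp 0 x); simpl in H. pose proof (rpow_ge0 (Mr b p r x) (/ r)); lra.
  - apply rpow_le_inv with r; [lra|apply rpow_ge0|].
    rewrite root_rpow by (try lra; apply Mr_ge0).
    pose proof (Mr_ub x [(O, S N)] Hx ltac:(simpl; lia)) as H. simpl in H. rewrite Rplus_0_r in H.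
    exact H.
Qed.

Lemma seg_sadd ab x y : seg ab (sadd x y) = sadd (seg ab x) (seg ab y).
Proof. apply functional_extensionality; intros k; unfold seg, sadd; seqcase; ring. Qed.

Lemma seg_sscal ab c x : seg ab (sscal c x) = sscal c (seg ab x).
Proof. apply functional_extensionality; intros k; unfold seg, sscal; seqcase; ring. Qed.

Lemma Mr_add l x y : mem b p x -> mem b p y -> 0 < l < 1 ->
  Mr b p r (sadd x y) <= rpow l (1 - r) * Mr b p r x + rpow (1 - l) (1 - r) * Mr b p r y.
Proof.
  intros Hx Hy Hl.
  assert (G1 := rpow_ge0 l (1 - r)). assert (G2 := rpow_ge0 (1 - l) (1 - r)).
  apply Rsup_le.
  { apply Rplus_le_le_0_compat; apply Rmult_le_pos; auto; apply Mr_ge0. }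
  intros v [c [Hc ->]].
  apply Rle_trans with (lsum (fun ab => rpow l (1 - r) * rpow (nm b p (seg ab x)) r
                               + rpow (1 - l) (1 - r) * rpow (nm b p (seg ab y)) r) c).
  - apply lsum_le. intros ab _. rewrite seg_sadd.
    eapply Rle_trans; [apply rpow_le; [lra|apply (nm_add Hb Hp); apply (mem_seg Hb)]|].
    apply rpow_add_le; try apply nm_ge0; auto; lra.
  - rewrite lsum_plus, !lsum_scal.
    apply Rplus_le_compat; apply Rmult_le_compat_l; auto; apply Mr_ub; auto.
Qed.

Lemma Mr_scal_le c x : mem b p x -> Mr b p r (sscal c x) <= rpow (Rabs c) r * Mr b p r x.
Proof.
  intros Hx. apply Rsup_le.
  { apply Rmult_le_pos; [apply rpow_ge0|apply Mr_ge0]. }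
  intros v [l [Hl ->]].
  apply Rle_trans with (lsum (fun ab => rpow (Rabs c) r * rpow (nm b p (seg ab x)) r) l).
  - apply lsum_le. intros ab _. rewrite seg_sscal, (nm_scal Hb Hp) by apply (mem_seg Hb).
    rewrite rpow_mul; [lra|apply Rabs_pos|apply nm_ge0].
  - rewrite lsum_scal. apply Rmult_le_compat_l; [apply rpow_ge0|apply Mr_ub; auto].
Qed.

Lemma rpow_nm_seg_mono ab cd x y :
  (forall k, Rabs (seg ab x k) <= Rabs (seg cd y k)) ->
  rpow (nm b p (seg ab x)) r <= rpow (nm b p (seg cd y)) r.
Proof.
  intros H. apply rpow_le; [lra|]. apply (nm_mono Hb Hp); auto. apply (mem_seg Hb).
Qed.

(** Intervals beyond [N] see only zeros and the one crossing [N] can be cut there. The clipped chain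
    ends by [N], so that [Mr_split] can append a chain for the tail. *)
Lemma chain_clip_trunc N x l lo : (lo <= N)%nat -> chain lo l ->
  exists l', chain lo l' /\ (forall ab, In ab l' -> (snd ab <= N)%nat) /\
    lsum (fun ab => rpow (nm b p (seg ab (trunc N x))) r) l
    <= lsum (fun ab => rpow (nm b p (seg ab x)) r) l'.
Proof.
  assert (Hz : forall l lo, (N <= lo)%nat -> chain lo l ->
     lsum (fun ab => rpow (nm b p (seg ab (trunc N x))) r) l <= 0).
  { clear l lo. induction l as [|ab l IH]; intros lo Hlo H; simpl; [lra|]. destruct H as [H1 [H2 H3]].
    specialize (IH (snd ab) ltac:(lia) H3).
    assert (E : rpow (nm b p (seg ab (trunc N x))) r = 0).
    { rewrite rpow_npos; auto.
      rewrite (nm_ext _ (trunc 0 x)).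
      - apply (nm_trunc_le Hb Hp 0 x).
      - intros k; unfold seg, trunc; seqcase; rewrite ?Rabs_R0; auto. }
    lra. }
  revert lo. induction l as [|ab l IH]; intros lo Hlo H.
  { exists []; simpl; repeat split; [tauto|lra]. }
  destruct H as [H1 [H2 H3]]. destruct (le_lt_dec (snd ab) N) as [H4|H4].
  - destruct (IH (snd ab) H4 H3) as [l' [H5 [H6 H7]]].
    exists (ab :: l'); repeat split; auto.
    + intros cd [<-|Hcd]; auto.
    + simpl. apply Rplus_le_compat; auto. apply rpow_nm_seg_mono.
      intros k; unfold seg, trunc; seqcase; rewrite ?Rabs_R0; lra.
  - specialize (Hz l (snd ab) ltac:(lia) H3).
    destruct (le_lt_dec N (fst ab)) as [H5|H5].
    + exists []; simpl; repeat split; [tauto|].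
      assert (E : rpow (nm b p (seg ab (trunc N x))) r = 0).
      { rewrite rpow_npos; auto.
        rewrite (nm_ext _ (trunc 0 x)).
        - apply (nm_trunc_le Hb Hp 0 x).
        - intros k; unfold seg, trunc; seqcase; rewrite ?Rabs_R0; auto. }
      lra.
    + exists [(fst ab, N)]; simpl; repeat split; auto.
      * intros cd [<-|[]]; auto.
      * assert (rpow (nm b p (seg ab (trunc N x))) r <= rpow (nm b p (seg (fst ab, N) x)) r); [|lra].
        apply rpow_nm_seg_mono. intros k; unfold seg, trunc; simpl; seqcase; rewrite ?Rabs_R0; lra.
Qed.

Lemma chain_clip_tail N x l lo : chain lo l ->
  exists l', chain (Nat.max lo N) l' /\
    lsum (fun ab => rpow (nm b p (seg ab (tail N x))) r) l
    <= lsum (fun ab => rpow (nm b p (seg ab x)) r) l'.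
Proof.
  revert lo. induction l as [|ab l IH]; intros lo H.
  { exists []; simpl; split; [auto|lra]. }
  destruct H as [H1 [H2 H3]]. destruct (IH _ H3) as [l' [H4 H5]].
  destruct (le_lt_dec (snd ab) N) as [H6|H6].
  - exists l'; split; [eapply chain_weaken; [|exact H4]; lia|]. simpl.
    assert (E : rpow (nm b p (seg ab (tail N x))) r = 0).
    { rewrite rpow_npos; auto. rewrite (nm_ext _ (trunc 0 x)).
      - apply (nm_trunc_le Hb Hp 0 x).
      - intros k; unfold seg, trunc, tail; seqcase; rewrite ?Rabs_R0; auto. }
    lra.
  - exists ((Nat.max (fst ab) N, snd ab) :: l'); simpl; repeat split; try lia.
    + eapply chain_weaken; [|exact H4]; lia.
    + apply Rplus_le_compat; auto. apply rpow_nm_seg_mono.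
      intros k; unfold seg, tail; simpl.
      destruct (Nat.ltb_spec k N), (Nat.leb_spec (fst ab) k), (Nat.leb_spec (Nat.max (fst ab) N) k),
        (Nat.ltb_spec k (snd ab)); simpl; rewrite ?Rabs_R0; try lra; try lia; apply Rabs_pos.
Qed.

(** A chain for the head followed by one for the tail is a chain for [x]. The constant 1 matters:
    the midpoint argument subtracts two nearly equal [r]-th powers. *)
Lemma Mr_split N x : mem b p x -> Mr b p r (trunc N x) + Mr b p r (tail N x) <= Mr b p r x.
Proof.
  intros Hx.
  assert (H : forall l1 l2, chain 0 l1 -> chain 0 l2 ->
     lsum (fun ab => rpow (nm b p (seg ab (trunc N x))) r) l1
     + lsum (fun ab => rpow (nm b p (seg ab (tail N x))) r) l2 <= Mr b p r x).
  { intros l1 l2 H1 H2.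
    destruct (chain_clip_trunc N x l1 0 ltac:(lia) H1) as [l1' [H3 [H4 H5]]].
    destruct (chain_clip_tail N x l2 0 H2) as [l2' [H6 H7]]. simpl in H6.
    eapply Rle_trans; [|apply (Mr_ub x (l1' ++ l2') Hx)].
    - rewrite lsum_app; lra.
    - apply chain_app with N; auto; lia. }
  assert (H' : forall l2, chain 0 l2 ->
     Mr b p r (trunc N x) <= Mr b p r x - lsum (fun ab => rpow (nm b p (seg ab (tail N x))) r) l2).
  { intros l2 H2. apply Rsup_le.
    - specialize (H [] l2 I H2). simpl in H. lra.
    - intros v [l1 [H1 ->]]. specialize (H l1 l2 H1 H2). lra. }
  assert (Mr b p r (tail N x) <= Mr b p r x - Mr b p r (trunc N x)); [|lra].
  apply Rsup_le.
  - specialize (H' [] I). simpl in H'. lra.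
  - intros v [l2 [H2 ->]]. specialize (H' l2 H2). lra.
Qed.

End LowerEstimate.

(** * The Tsirelson and l_1 norms *)

Lemma lsum_rsum {A} (l : list A) N (f : A -> nat -> R) :
  lsum (fun a => rsum N (f a)) l = rsum N (fun k => lsum (fun a => f a k) l).
Proof.
  induction N; simpl.
  - induction l; simpl; lra.
  - rewrite lsum_plus, IHN; auto.
Qed.

Lemma lsum_map {A B} (f : B -> R) (g : A -> B) (l : list A) :
  lsum f (map g l) = lsum (fun a => f (g a)) l.
Proof. induction l; simpl; [auto|]. rewrite IHl; auto. Qed.

(** For increasing sequences one index serves all terms, so supremum and finite sum commute. This
    carries the admissible estimate from the Tsirelson iterates to their limit. *)
Lemma lsum_sup {A} (f : nat -> A -> R) (l : list A) (C : R) :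
  (forall m a, 0 <= f m a) -> (forall m m' a, (m <= m')%nat -> f m a <= f m' a) ->
  (forall m, lsum (f m) l <= C) ->
  lsum (fun a => Rsup (fun r => exists m, r = f m a)) l <= C.
Proof.
  intros H0 Hm. revert C. induction l as [|a l IH]; intros C H; [apply (H O)|].
  simpl.
  assert (H1 : forall m, lsum (fun a => Rsup (fun r => exists m, r = f m a)) l <= C - f m a).
  { intros m. apply IH. intros m'. specialize (H (Nat.max m m')). simpl in H.
    pose proof (Hm m (Nat.max m m') a ltac:(lia)).
    assert (lsum (f m') l <= lsum (f (Nat.max m m')) l) by (apply lsum_le; intros; apply Hm; lia).
    lra. }
  assert (Rsup (fun r => exists m, r = f m a) <= C - lsum (fun a => Rsup (fun r => exists m, r = f m a)) l); [|lra].
  apply Rsup_le.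
  - specialize (H1 O). specialize (H0 O a). lra.
  - intros r [m ->]. specialize (H1 m). lra.
Qed.

Lemma c00_le_rsum x N k : (forall j, (N <= j)%nat -> x j = 0) -> Rabs (x k) <= rsum N (fun j => Rabs (x j)).
Proof.
  intros H. destruct (le_lt_dec N k) as [Hk|Hk].
  - rewrite H, Rabs_R0 by auto. apply rsum_ge0; intros; apply Rabs_pos.
  - apply (rsum_term N (fun j => Rabs (x j))); auto. intros; apply Rabs_pos.
Qed.

Lemma norm0_ub x k : c00 x -> Rabs (x k) <= norm0 x.
Proof.
  intros [N H]. apply Rsup_ub; eauto. exists (rsum N (fun j => Rabs (x j))).
  intros r [j ->]. apply c00_le_rsum; auto.
Qed.

Lemma norm0_ge0 x : 0 <= norm0 x.
Proof. apply Rsup_ge0; intros r [k ->]; apply Rabs_pos. Qed.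

Lemma norm0_le x C : (forall k, Rabs (x k) <= C) -> norm0 x <= C.
Proof.
  intros H. apply Rsup_le; [eapply Rle_trans; [apply Rabs_pos|apply (H O)]|].
  intros r [k ->]; auto.
Qed.

Lemma restr_zero E x k : x k = 0 -> restr E x k = 0.
Proof. unfold restr; destruct (in_dec _ _ _); auto. Qed.

Lemma c00_restr E x : c00 x -> c00 (restr E x).
Proof. intros [N H]; exists N; intros k Hk; apply restr_zero; auto. Qed.
#[local] Hint Resolve c00_restr : core.

(** The sets of an admissible family are pairwise disjoint, so at most one of them contains [k]. *)
Lemma admissible_abs_le Es x k : admissible Es -> lsum (fun E => Rabs (restr E x k)) Es <= Rabs (x k).
Proof.
  intros [_ [_ H]]. revert H. induction Es as [|E Es IH]; intros H; simpl; [apply Rabs_pos|].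
  unfold restr at 1. destruct (in_dec Nat.eq_dec k E) as [Hk|Hk].
  - assert (lsum (fun E => Rabs (restr E x k)) Es <= 0); [|lra].
    assert (Hz : forall F, In F Es -> Rabs (restr F x k) <= 0).
    { intros F HF. unfold restr; destruct (in_dec Nat.eq_dec k F) as [Hk'|Hk']; [|rewrite Rabs_R0; lra].
      exfalso. destruct (In_nth Es F [] HF) as [j [Hj1 Hj2]].
      specialize (H O (S j) ltac:(lia) ltac:(simpl; lia) k k). simpl in H. rewrite Hj2 in H.
      specialize (H Hk Hk'). lia. }
    clear IH H. induction Es as [|F Es IH]; simpl; [lra|].
    pose proof (Hz F ltac:(left; auto)). specialize (IH ltac:(intros; apply Hz; right; auto)). lra.
  - rewrite Rabs_R0, Rplus_0_l. apply IH. intros i j Hij Hj a b Ha Hb'.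
    apply (H (S i) (S j)); simpl; auto; lia.
Qed.

Definition tsir_sums (m : nat) (x : nat -> R) : R -> Prop :=
  fun r => exists Es, admissible Es /\ r = lsum (fun E => tsir_iter m (restr E x)) Es.

Lemma tsir_iter_S m x : tsir_iter (S m) x = Rmax (norm0 x) (/ 2 * Rsup (tsir_sums m x)).
Proof. reflexivity. Qed.

Lemma tsir_iter_ge0 m x : 0 <= tsir_iter m x.
Proof.
  destruct m; [apply norm0_ge0|]. rewrite tsir_iter_S.
  eapply Rle_trans; [apply norm0_ge0|apply Rmax_l].
Qed.

Lemma norm0_le_tsir_iter m x : norm0 x <= tsir_iter m x.
Proof. destruct m; [simpl; lra|]. rewrite tsir_iter_S; apply Rmax_l. Qed.

Lemma tsir_iter_S_le m x C : norm0 x <= C ->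
  (forall Es, admissible Es -> lsum (fun E => tsir_iter m (restr E x)) Es <= 2 * C) ->
  tsir_iter (S m) x <= C.
Proof.
  intros H0 H. pose proof (norm0_ge0 x). rewrite tsir_iter_S. apply Rmax_lub; auto.
  assert (Rsup (tsir_sums m x) <= 2 * C); [|lra].
  apply Rsup_le; [lra|]. intros r [Es [HE ->]]; auto.
Qed.

(** The bound does not depend on [m]: it bounds the suprema in the iterates and in their limit, so
    that [Rsup_ub] applies to both. *)
Lemma tsir_iter_bound m x N : (forall k, (N <= k)%nat -> x k = 0) ->
  tsir_iter m x <= rsum N (fun k => Rabs (x k)).
Proof.
  revert x; induction m; intros x Hx.
  - apply norm0_le. intros k; apply c00_le_rsum; auto.
  - apply tsir_iter_S_le; [apply norm0_le; intros k; apply c00_le_rsum; auto|].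
    intros Es HE.
    apply Rle_trans with (lsum (fun E => rsum N (fun k => Rabs (restr E x k))) Es).
    + apply lsum_le; intros E _. apply IHm. intros k Hk; apply restr_zero; auto.
    + rewrite lsum_rsum. apply Rle_trans with (rsum N (fun k => Rabs (x k))).
      * apply rsum_le; intros k _. apply admissible_abs_le; auto.
      * assert (0 <= rsum N (fun k => Rabs (x k))) by (apply rsum_ge0; intros; apply Rabs_pos). lra.
Qed.

Lemma tsir_iter_S_ub m x Es : c00 x -> admissible Es ->
  lsum (fun E => tsir_iter m (restr E x)) Es <= 2 * tsir_iter (S m) x.
Proof.
  intros [N Hx] HE.
  assert (H : lsum (fun E => tsir_iter m (restr E x)) Es <= Rsup (tsir_sums m x)).
  { apply Rsup_ub; [|exists Es; auto].
    exists (rsum N (fun k => Rabs (x k))). intros r [Fs [HF ->]].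
    apply Rle_trans with (lsum (fun E => rsum N (fun k => Rabs (restr E x k))) Fs).
    + apply lsum_le; intros E _. apply tsir_iter_bound. intros k Hk; apply restr_zero; auto.
    + rewrite lsum_rsum. apply rsum_le; intros k _. apply admissible_abs_le; auto. }
  rewrite tsir_iter_S. pose proof (Rmax_r (norm0 x) (/ 2 * Rsup (tsir_sums m x))). lra.
Qed.

Lemma tsir_iter_mono m x y : c00 y -> (forall k, Rabs (x k) <= Rabs (y k)) ->
  tsir_iter m x <= tsir_iter m y.
Proof.
  revert x y; induction m; intros x y Hy H.
  - apply norm0_le. intros k; eapply Rle_trans; [apply H|apply norm0_ub; auto].
  - apply tsir_iter_S_le.
    + apply norm0_le. intros k; eapply Rle_trans; [apply H|].
      eapply Rle_trans; [apply norm0_ub; auto|apply norm0_le_tsir_iter].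
    + intros Es HE. eapply Rle_trans; [|apply (tsir_iter_S_ub m y Es Hy HE)].
      apply lsum_le. intros E _. apply IHm; auto.
      intros k; unfold restr; destruct (in_dec _ _ _); [auto|lra].
Qed.

Lemma tsir_iter_add m x y : c00 x -> c00 y -> tsir_iter m (sadd x y) <= tsir_iter m x + tsir_iter m y.
Proof.
  revert x y; induction m; intros x y Hx Hy.
  - apply norm0_le. intros k; eapply Rle_trans; [apply Rabs_triang|].
    apply Rplus_le_compat; apply norm0_ub; auto.
  - apply tsir_iter_S_le.
    + apply norm0_le. intros k; eapply Rle_trans; [apply Rabs_triang|].
      apply Rplus_le_compat; (eapply Rle_trans; [apply norm0_ub; auto|apply norm0_le_tsir_iter]).
    + intros Es HE. pose proof (tsir_iter_S_ub m x Es Hx HE). pose proof (tsir_iter_S_ub m y Es Hy HE).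
      apply Rle_trans with (lsum (fun E => tsir_iter m (restr E x) + tsir_iter m (restr E y)) Es).
      * apply lsum_le. intros E _. replace (restr E (sadd x y)) with (sadd (restr E x) (restr E y)); auto.
        apply functional_extensionality; intros k; unfold restr, sadd; destruct (in_dec _ _ _); lra.
      * rewrite lsum_plus; lra.
Qed.

Lemma tsir_iter_scal m c x : c00 x -> 0 <= c -> tsir_iter m (sscal c x) <= c * tsir_iter m x.
Proof.
  intros Hx Hc.
  assert (H0 : forall x, c00 x -> norm0 (sscal c x) <= c * norm0 x).
  { intros y Hy. apply norm0_le. intros k; unfold sscal; rewrite Rabs_mult, (Rabs_pos_eq c) by auto.
    apply Rmult_le_compat_l; auto; apply norm0_ub; auto. }
  revert x Hx; induction m; intros x Hx; [apply H0; auto|].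
  apply tsir_iter_S_le.
  - eapply Rle_trans; [apply H0; auto|]. apply Rmult_le_compat_l; auto; apply norm0_le_tsir_iter.
  - intros Es HE. pose proof (tsir_iter_S_ub m x Es Hx HE) as H.
    apply Rle_trans with (lsum (fun E => c * tsir_iter m (restr E x)) Es).
    + apply lsum_le. intros E _. replace (restr E (sscal c x)) with (sscal c (restr E x)); auto.
      apply functional_extensionality; intros k; unfold restr, sscal; destruct (in_dec _ _ _); lra.
    + rewrite lsum_scal. nra.
Qed.

Lemma tsir_iter_incr m m' x : c00 x -> (m <= m')%nat -> tsir_iter m x <= tsir_iter m' x.
Proof.
  intros Hx Hm. revert x Hx. revert m Hm; induction m'; intros m Hm x Hx.
  - replace m with O by lia; lra.
  - destruct m as [|m]; [apply norm0_le_tsir_iter|].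
    apply tsir_iter_S_le; [apply norm0_le_tsir_iter|].
    intros Es HE. eapply Rle_trans; [|apply (tsir_iter_S_ub m' x Es Hx HE)].
    apply lsum_le; intros E _. apply IHm'; auto; lia.
Qed.

Lemma tsir_c00_ub m x : c00 x -> tsir_iter m x <= tsir_c00 x.
Proof.
  intros [N Hx]. apply Rsup_ub; eauto. exists (rsum N (fun k => Rabs (x k))).
  intros r [j ->]. apply tsir_iter_bound; auto.
Qed.

Lemma tsir_c00_le x C : (forall m, tsir_iter m x <= C) -> tsir_c00 x <= C.
Proof.
  intros H. apply Rsup_le; [eapply Rle_trans; [apply (tsir_iter_ge0 O)|apply H]|].
  intros r [m ->]; auto.
Qed.

Lemma chain_nth lo l i j : chain lo l -> (i < j)%nat -> (j < length l)%nat ->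
  (snd (nth i l (O, O)) <= fst (nth j l (O, O)))%nat.
Proof.
  revert lo i j; induction l as [|ab l IH]; intros lo i j H Hij Hj; simpl in Hj; [lia|].
  destruct H as [H1 [H2 H3]]. destruct j as [|j]; [lia|]. simpl.
  destruct i as [|i]; [|apply (IH (snd ab)); auto; lia].
  assert (Hin : In (nth j l (O, O)) l) by (apply nth_In; lia).
  revert H3 Hin. generalize (nth j l (O, O)) as cd. generalize (snd ab) as lo'. clear.
  induction l as [|ef l IH]; simpl; [tauto|]. intros lo' cd [H1 [H2 H3]] [->|H]; auto.
  specialize (IH _ _ H3 H). lia.
Qed.

Lemma chain_admissible lo l : chain lo l -> (length l <= S lo)%nat ->
  admissible (map (fun ab => seq (fst ab) (snd ab - fst ab)) l).
Proof.
  intros Hc Hl. set (f := fun ab : nat * nat => seq (fst ab) (snd ab - fst ab)).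
  split; [|split].
  - intros E HE. apply in_map_iff in HE. destruct HE as [ab [<- Hab]].
    assert (H : (fst ab < snd ab)%nat).
    { clear Hl. revert lo Hc. induction l as [|cd l IH]; simpl in *; [tauto|].
      intros lo [H1 [H2 H3]]. destruct Hab as [->|Hab]; eauto. }
    unfold f. replace (snd ab - fst ab)%nat with (S (snd ab - fst ab - 1)) by lia. discriminate.
  - intros a Ha. rewrite length_map. destruct l as [|ab l]; simpl in *; [lia|].
    unfold f in Ha; apply in_seq in Ha. lia.
  - intros i j Hij Hj a c Ha Hc'. rewrite length_map in Hj.
    (* The default of [nth] must be the image of a pair for [map_nth]; the empty interval [(O, O)]
       has image [[]]. *)
    change (@nil nat) with (f (O, O)) in Ha, Hc'. rewrite map_nth in Ha, Hc'.
    unfold f in Ha, Hc'. apply in_seq in Ha. apply in_seq in Hc'.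
    pose proof (chain_nth lo l i j Hc Hij Hj). lia.
Qed.

Lemma restr_seq ab x : restr (seq (fst ab) (snd ab - fst ab)) x = seg ab x.
Proof.
  apply functional_extensionality; intros k; unfold restr, seg.
  destruct (in_dec _ _ _) as [H|H]; rewrite in_seq in H; seqcase; auto.
Qed.

Lemma tsir_bnorm : bnorm tsir_c00.
Proof.
  split.
  - intros x Hx. eapply Rle_trans; [apply (tsir_iter_ge0 O)|apply tsir_c00_ub; auto].
  - intros x y Hx Hy. apply tsir_c00_le. intros m.
    eapply Rle_trans; [apply tsir_iter_add; auto|]. apply Rplus_le_compat; apply tsir_c00_ub; auto.
  - intros c x Hx Hc. apply tsir_c00_le. intros m.
    eapply Rle_trans; [apply tsir_iter_scal; auto|]. apply Rmult_le_compat_l; auto; apply tsir_c00_ub; auto.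
  - intros x y Hy H. apply tsir_c00_le. intros m.
    eapply Rle_trans; [apply tsir_iter_mono; eauto|apply tsir_c00_ub; auto].
  - intros n. apply Rle_antisym.
    + apply tsir_c00_le. intros m. eapply Rle_trans; [apply (tsir_iter_bound m (ev n) (S n))|].
      { intros k Hk; unfold ev; seqcase; auto. }
      simpl. replace (rsum n (fun k => Rabs (ev n k))) with 0.
      { unfold ev; rewrite Nat.eqb_refl, Rabs_R1; lra. }
      rewrite (rsum_ext n _ (fun _ => 0)), rsum_const; [ring|].
      intros i Hi; unfold ev; seqcase. apply Rabs_R0.
    + eapply Rle_trans; [|apply (tsir_c00_ub O); auto].
      eapply Rle_trans; [|apply (norm0_ub _ n); auto].
      unfold ev; rewrite Nat.eqb_refl, Rabs_R1; lra.
  - intros x lo l Hx Hc Hl.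
    assert (Hs : forall ab, c00 (seg ab x)).
    { intros ab; exists (snd ab); intros k Hk; unfold seg; seqcase; auto. }
    apply (lsum_sup (fun m ab => tsir_iter m (seg ab x))).
    + intros; apply tsir_iter_ge0.
    + intros; apply tsir_iter_incr; auto.
    (* The factor 2 of [bn_low] undoes the 1/2 in Tsirelson's formula, at the price of one more
       iteration. *)
    + intros m. pose proof (tsir_iter_S_ub m x _ Hx (chain_admissible lo l Hc Hl)) as H.
      rewrite lsum_map in H.
      apply Rle_trans with (2 * tsir_iter (S m) x).
      * eapply Rle_trans; [|exact H]. apply lsum_le. intros ab _. rewrite restr_seq; lra.
      * apply Rmult_le_compat_l; [lra|apply tsir_c00_ub; auto].
Qed.

(** * The l_1 norm *)

Definition l1norm (x : nat -> R) : R := Rsup (fun r => exists N, r = rsum N (fun k => Rabs (x k))).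

Lemma rsum_abs_incr x N M : (N <= M)%nat -> rsum N (fun k => Rabs (x k)) <= rsum M (fun k => Rabs (x k)).
Proof.
  induction 1; [lra|]. simpl. pose proof (Rabs_pos (x m)). lra.
Qed.

Lemma l1norm_fin x N : (forall k, (N <= k)%nat -> x k = 0) -> l1norm x = rsum N (fun k => Rabs (x k)).
Proof.
  intros H.
  assert (HM : forall M, rsum M (fun k => Rabs (x k)) <= rsum N (fun k => Rabs (x k))).
  { intros M. destruct (le_lt_dec M N); [apply rsum_abs_incr; auto|].
    apply Req_le. clear -H l. induction l; simpl; [rewrite H, Rabs_R0 by lia; lra|].
    rewrite IHl, H, Rabs_R0 by lia; lra. }
  apply Rle_antisym.
  - apply Rsup_le; [apply rsum_ge0; intros; apply Rabs_pos|]. intros r [M ->]; auto.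
  - apply Rsup_ub; eauto. exists (rsum N (fun k => Rabs (x k))). intros r [M ->]; auto.
Qed.

Lemma l1_bnorm : bnorm l1norm.
Proof.
  split.
  - intros x [N HN]. rewrite (l1norm_fin x N HN). apply rsum_ge0; intros; apply Rabs_pos.
  - intros x y [N HN] [M HM].
    assert (H1 : forall k, (Nat.max N M <= k)%nat -> x k = 0) by (intros; apply HN; lia).
    assert (H2 : forall k, (Nat.max N M <= k)%nat -> y k = 0) by (intros; apply HM; lia).
    rewrite (l1norm_fin x _ H1), (l1norm_fin y _ H2), (l1norm_fin (sadd x y) (Nat.max N M)).
    + rewrite <- rsum_plus. apply rsum_le. intros; apply Rabs_triang.
    + intros k Hk; unfold sadd; rewrite H1, H2 by auto; ring.
  - intros c x [N HN] Hc. rewrite (l1norm_fin x _ HN), (l1norm_fin (sscal c x) N).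
    + rewrite <- rsum_scal. apply rsum_le. intros; unfold sscal; rewrite Rabs_mult, (Rabs_pos_eq c); lra.
    + intros k Hk; unfold sscal; rewrite HN by auto; ring.
  - intros x y [N HN] H. rewrite (l1norm_fin y _ HN), (l1norm_fin x N).
    + apply rsum_le; auto.
    + intros k Hk. specialize (H k). rewrite (HN k Hk), Rabs_R0 in H.
      destruct (Req_dec (x k) 0); auto. pose proof (Rabs_pos_lt _ H0); lra.
  - intros n. rewrite (l1norm_fin (ev n) (S n)) by (intros k Hk; unfold ev; seqcase; auto).
    simpl. rewrite (rsum_ext n _ (fun _ => 0)), rsum_const.
    + unfold ev; rewrite Nat.eqb_refl, Rabs_R1; ring.
    + intros i Hi; unfold ev; seqcase. apply Rabs_R0.
  - intros x lo l [N HN] Hc _. rewrite (l1norm_fin x _ HN).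
    apply Rle_trans with (rsum N (fun k => Rabs (x k))).
    2:{ assert (0 <= rsum N (fun k => Rabs (x k))) by (apply rsum_ge0; intros; apply Rabs_pos); lra. }
    apply Rle_trans with (lsum (fun ab => rsum N (fun k => Rabs (seg ab x k))) l).
    + apply lsum_le. intros ab _. rewrite (l1norm_fin (seg ab x) N); [lra|].
      intros k Hk; unfold seg; seqcase; auto.
    + rewrite lsum_rsum. apply rsum_le. intros k _.
      assert (Hg : forall l lo, chain lo l -> (k < lo)%nat -> lsum (fun ab => Rabs (seg ab x k)) l <= 0).
      { clear. induction l as [|ab l IH]; simpl; intros lo H Hk; [lra|]. destruct H as [H1 [H2 H3]].
        specialize (IH _ H3 ltac:(lia)). unfold seg at 1; seqcase; rewrite Rabs_R0; lra. }
      clear HN. revert lo Hc; induction l as [|ab l IH]; simpl; intros lo H; [apply Rabs_pos|].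
      destruct H as [H1 [H2 H3]]. specialize (IH _ H3).
      unfold seg at 1. destruct (Nat.leb_spec (fst ab) k), (Nat.ltb_spec k (snd ab)); simpl;
        rewrite ?Rabs_R0; try lra. specialize (Hg l (snd ab) H3 H0). lra.
Qed.

(** * Identification of [T^p] and [l_p] with the abstract convexifications *)

Lemma nmp_cv b p x : bnorm b -> mem b p x -> Un_cv (fun N => b (trunc N (pw p x))) (nmp b p x).
Proof.
  intros Hb Hx e He.
  assert (HN : exists N, nmp b p x - e < b (trunc N (pw p x))).
  { apply NNPP; intros Hn.
    destruct (Rle_lt_dec 0 (nmp b p x - e)) as [H0|H0].
    - assert (nmp b p x <= nmp b p x - e); [|lra].
      apply (nmp_le x); auto. intros N. apply Rnot_lt_le; intros H; apply Hn; eauto.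
    - apply Hn. exists O. pose proof (bn_trunc_ge0 Hb O (pw p x)). lra. }
  destruct HN as [N HN]. exists N. intros n Hn.
  pose proof (nmp_ub x n Hx).
  assert (b (trunc N (pw p x)) <= b (trunc n (pw p x))).
  { apply (bn_mono_nonneg Hb); auto. intros k; split; [apply trunc_pw_ge0|].
    unfold trunc; seqcase; try lra. apply pw_ge0. }
  unfold Rdist. rewrite Rabs_left1; lra.
Qed.

(** Cauchy truncations are bounded. Conversely, a difference of two late truncations is dominated by
    a tail, which is small by bounded completeness. *)
Lemma in_Tp_mem p x : 1 <= p -> in_Tp p x <-> mem tsir_c00 p x.
Proof.
  intros Hp. pose proof tsir_bnorm as Hb. split.
  - intros H. destruct (H 1 ltac:(lra)) as [N HN].
    exists (tsir_c00 (trunc N (pw p x)) + 1). intros m.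
    assert (Hm : tsir_c00 (trunc m (pw p x)) <= tsir_c00 (trunc (Nat.max N m) (pw p x))).
    { apply (bn_mono_nonneg Hb); auto. intros k; split; [apply trunc_pw_ge0|].
      unfold trunc. destruct (Nat.ltb_spec k m), (Nat.ltb_spec k (Nat.max N m)); try lra; try lia. apply pw_ge0. }
    eapply Rle_trans; [exact Hm|].
    specialize (HN (Nat.max N m) N ltac:(lia) ltac:(lia)).
    pose proof (bn_add _ Hb (trunc N (pw p x)) (seq_sub (trunc (Nat.max N m) (pw p x)) (trunc N (pw p x)))
      (c00_trunc _ _)) as H1.
    replace (sadd (trunc N (pw p x)) (seq_sub (trunc (Nat.max N m) (pw p x)) (trunc N (pw p x))))
      with (trunc (Nat.max N m) (pw p x)) in H1
      by (apply functional_extensionality; intros k; unfold sadd, seq_sub; ring).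
    specialize (H1 ltac:(exists (Nat.max N m); intros k Hk; unfold seq_sub, trunc;
      destruct (Nat.ltb_spec k (Nat.max N m)), (Nat.ltb_spec k N); try lia; ring)).
    lra.
  - intros Hx e He. destruct (nmp_tail_small Hb x (e / 2) Hx ltac:(lra)) as [N HN].
    exists N. intros m k Hm Hk.
    assert (H : tsir_c00 (trunc (Nat.max m k) (pw p (tail N x))) <= e / 2).
    { eapply Rle_trans; [|exact HN]. apply nmp_ub. apply (mem_tail Hb); auto. }
    eapply Rle_lt_trans; [|apply Rle_lt_trans with (1 := H); lra].
    apply (bn_mono _ Hb); auto. intros j.
    rewrite (Rabs_pos_eq (trunc _ _ _)) by apply trunc_pw_ge0.
    pose proof (pw_ge0 p x j).
    unfold seq_sub, trunc, tail, pw in *.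
    destruct (Nat.ltb_spec j m), (Nat.ltb_spec j k), (Nat.ltb_spec j (Nat.max m k)), (Nat.ltb_spec j N);
      try lia; rewrite ?Rabs_R0, ?rpow_0, ?Rminus_0_r, ?Rminus_diag, ?Rminus_0_l, ?Rabs_Ropp, ?Rabs_R0;
      try lra; rewrite Rabs_pos_eq; lra.
Qed.

Lemma Tp_norm_nm p x : mem tsir_c00 p x -> Tp_norm p x = nm tsir_c00 p x.
Proof.
  intros Hx. unfold Tp_norm, nm, T_norm. f_equal.
  apply Rsup_singleton.
  - apply nmp_cv; auto. apply tsir_bnorm.
  - intros l Hl. eapply UL_sequence; [exact Hl|]. apply nmp_cv; auto. apply tsir_bnorm.
Qed.

Lemma sum_pw_l1 p x N : sum_f_R0 (pw p x) N = l1norm (trunc (S N) (pw p x)).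
Proof.
  rewrite (l1norm_fin _ (S N)) by (intros k Hk; unfold trunc; seqcase; auto).
  assert (E : forall M, (M <= N)%nat -> sum_f_R0 (pw p x) M = rsum (S M) (fun k => Rabs (trunc (S N) (pw p x) k))).
  { induction M; intros HM; cbn [sum_f_R0 rsum].
    - unfold trunc; seqcase. rewrite Rabs_pos_eq by apply pw_ge0; ring.
    - rewrite IHM by lia. cbn [rsum]. f_equal. unfold trunc; destruct (Nat.ltb_spec (S M) (S N)); [|lia].
      rewrite Rabs_pos_eq by apply pw_ge0; auto. }
  apply E; auto.
Qed.

Lemma lp_cv p x : mem l1norm p x -> Un_cv (fun N => sum_f_R0 (pw p x) N) (nmp l1norm p x).
Proof.
  intros Hx e He. destruct (nmp_cv _ _ _ l1_bnorm Hx e He) as [N HN].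
  exists N. intros n Hn. rewrite sum_pw_l1. apply HN; lia.
Qed.

Lemma in_lp_mem p x : in_lp p x <-> mem l1norm p x.
Proof.
  split.
  - intros [s Hs]. exists s. intros [|N].
    + rewrite (l1norm_fin _ O) by (intros k Hk; unfold trunc; seqcase; auto). simpl.
      apply Rle_trans with (sum_f_R0 (pw p x) 0); [simpl; apply pw_ge0|].
      apply (growing_ineq (fun N => sum_f_R0 (pw p x) N)); auto.
      intros n; simpl. pose proof (pw_ge0 p x (S n)); lra.
    + rewrite <- sum_pw_l1. apply (growing_ineq (fun N => sum_f_R0 (pw p x) N)); auto.
      intros n; simpl. pose proof (pw_ge0 p x (S n)); lra.
  - intros Hx. exists (nmp l1norm p x). apply lp_cv; auto.
Qed.

Lemma lp_norm_nm p x : mem l1norm p x -> lp_norm p x = nm l1norm p x.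
Proof.
  intros Hx. unfold lp_norm, nm. f_equal.
  apply Rsup_singleton; [apply lp_cv; auto|].
  intros l Hl. eapply UL_sequence; [exact Hl|]. apply lp_cv; auto.
Qed.

(** * Iterated weak limits *)

(** A nonprincipal ultrafilter: [ultra_inf] gives properness as well. All bounded sequences converge
    along it at once, so iterated limits require no extraction of subsequences. *)
Record ultra (U : (nat -> Prop) -> Prop) : Prop := {
  ultra_mono : forall P Q : nat -> Prop, (forall n, P n -> Q n) -> U P -> U Q;
  ultra_and : forall P Q : nat -> Prop, U P -> U Q -> U (fun n => P n /\ Q n);
  ultra_dec : forall P : nat -> Prop, U P \/ U (fun n => ~ P n);
  ultra_inf : forall P : nat -> Prop, U P -> forall N, exists n, (N <= n)%nat /\ P n }.

Lemma ultra_exists : exists U, ultra U.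
Proof.
  set (F := fun P : nat -> Prop => exists N, forall n, (N <= n)%nat -> P n).
  assert (PF : @filter.ProperFilter nat F).
  { split.
    - intros [N HN]. exact (HN N (Nat.le_refl N)).
    - split.
      + exists O; intros; exact I.
      + intros P Q [N HN] [M HM]. exists (Nat.max N M); intros n Hn.
        split; [apply HN|apply HM]; lia.
      + intros P Q H [N HN]. exists N; intros n Hn; apply H, HN, Hn. }
  destruct (@filter.ultraFilterLemma nat F PF) as [U [HU HF]].
  pose proof (@filter.ultra_proper nat U HU) as [Hne [HT HI HS]].
  exists U; split.
  - intros P Q H HP; exact (HS P Q H HP).
  - intros P Q HP HQ; exact (HI P Q HP HQ).
  - intros P. exact (@filter.in_ultra_setVsetC nat U P HU).
  - intros P HP N. apply NNPP; intros Hn. apply Hne.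
    assert (HN : U (fun n => (N <= n)%nat)) by (apply HF; exists N; auto).
    eapply HS; [|exact (HI _ _ HP HN)]. intros n [H1 H2]. apply Hn; eauto.
Qed.

(** The limit along [U] as the supremum of its lower cut; meaningful for bounded sequences
    ([ulim_spec]). *)
Definition ulim (U : (nat -> Prop) -> Prop) (x : nat -> R) : R := Rsup (fun a => U (fun n => a <= x n)).

Section Ultralimits.
Context {U : (nat -> Prop) -> Prop} (HU : ultra U).

Lemma ultra_ex P : U P -> exists n, P n.
Proof. intros H. destruct (ultra_inf U HU P H O) as [n [_ Hn]]; eauto. Qed.

Lemma ultra_all (P : nat -> Prop) : (forall n, P n) -> U P.
Proof.
  intros H. destruct (ultra_dec U HU P) as [H1|H1]; auto.
  destruct (ultra_ex _ H1) as [n Hn]; exfalso; auto.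
Qed.

Lemma ultra_forall N (P : nat -> nat -> Prop) :
  (forall i, (i < N)%nat -> U (P i)) -> U (fun n => forall i, (i < N)%nat -> P i n).
Proof.
  induction N; intros H; [apply ultra_all; lia|].
  eapply (ultra_mono U HU); [|apply (ultra_and U HU); [apply IHN; intros i Hi; apply (H i); lia|apply (H N); lia]].
  intros n [H1 H2] i Hi. destruct (Nat.eq_dec i N); [subst; auto|apply H1; lia].
Qed.

Lemma ulim_spec x C : (forall n, Rabs (x n) <= C) -> forall e, 0 < e -> U (fun n => Rabs (x n - ulim U x) < e).
Proof.
  intros H e He.
  assert (Hbd : bound (fun a => U (fun n => a <= x n))).
  { exists C. intros a Ha. destruct (ultra_ex _ Ha) as [n Hn].
    specialize (H n). pose proof (Rle_abs (x n)). lra. }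
  assert (H1 : U (fun n => x n < ulim U x + e)).
  { destruct (ultra_dec U HU (fun n => ulim U x + e <= x n)) as [H1|H1].
    - exfalso. pose proof (Rsup_ub _ _ Hbd H1). fold (ulim U x) in H0. lra.
    - eapply (ultra_mono U HU); [|exact H1]. intros n Hn; simpl in Hn; lra. }
  assert (H2 : U (fun n => ulim U x - e < x n)).
  { apply NNPP; intros Hn.
    assert (Hle : forall a, U (fun n => a <= x n) -> a <= ulim U x - e).
    { intros a Ha. apply Rnot_lt_le; intros Hlt. apply Hn.
      eapply (ultra_mono U HU); [|exact Ha]. intros n Hx; simpl in Hx; lra. }
    assert (HC : U (fun n => - C <= x n)).
    { apply ultra_all. intros n. specialize (H n). pose proof (Rle_abs (- x n)). rewrite Rabs_Ropp in H0. lra. }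
    unfold ulim in *. revert Hle. unfold Rsup.
    destruct (excluded_middle_informative _) as [Hx|Hx]; [|exfalso; apply Hx; eauto].
    destruct (completeness _ _ _) as [s [Hs1 Hs2]]; simpl. intros Hle.
    specialize (Hs2 (s - e) Hle). lra. }
  eapply (ultra_mono U HU); [|apply (ultra_and U HU); [exact H1|exact H2]].
  intros n [H3 H4]. apply Rabs_def1; lra.
Qed.

Definition wlim (X : nat -> nat -> R) (y : nat -> R) : Prop :=
  forall k e, 0 < e -> U (fun n => Rabs (X n k - y k) < e).

Lemma wlim_const x : wlim (fun _ => x) x.
Proof.
  intros k e He. apply ultra_all. intros _. rewrite Rminus_diag, Rabs_R0; auto.
Qed.

Lemma wlim_sub X Y x y : wlim X x -> wlim Y y -> wlim (fun n => seq_sub (X n) (Y n)) (seq_sub x y).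
Proof.
  intros HX HY k e He. eapply (ultra_mono U HU);
    [|apply (ultra_and U HU); [apply (HX k (e / 2)); lra|apply (HY k (e / 2)); lra]].
  intros n [H1 H2]. unfold seq_sub.
  replace (X n k - Y n k - (x k - y k)) with ((X n k - x k) - (Y n k - y k)) by ring.
  eapply Rle_lt_trans; [apply Rabs_triang|]. rewrite Rabs_Ropp. lra.
Qed.

(** Lower semicontinuity of the norm: on each truncation, coordinatewise convergence is norm
    convergence. *)
Lemma wlim_nm {b p} (Hb : bnorm b) (Hp : 1 <= p) X y C : wlim X y ->
  (forall n, mem b p (X n) /\ nm b p (X n) <= C) -> mem b p y /\ nm b p y <= C.
Proof.
  intros Hw HX. apply (nm_fatou Hb Hp). intros N.
  apply le_epsilon. intros e He.
  (* The error [e] is spread over [N] coordinates; the [+ 1] keeps the divisor positive when [N] is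
     0. *)
  assert (HN : 0 < INR N + 1) by (pose proof (pos_INR N); lra).
  destruct (ultra_ex (fun n => forall k, (k < N)%nat -> Rabs (X n k - y k) < e / (INR N + 1))) as [n Hn].
  { apply (ultra_forall N (fun k n => Rabs (X n k - y k) < e / (INR N + 1))). intros k _. apply Hw. apply Rdiv_lt_0_compat; auto. }
  destruct (HX n) as [H1 H2].
  assert (H3 : nm b p (trunc N (X n)) <= C).
  { eapply Rle_trans; [|exact H2]. apply (nm_mono Hb Hp); auto.
    intros k; unfold trunc; seqcase; rewrite ?Rabs_R0; [lra|apply Rabs_pos]. }
  pose proof (nm_trunc_le Hb Hp N (seq_sub (X n) y)) as H4.
  assert (H5 : rsum N (fun k => Rabs (seq_sub (X n) y k)) <= e).
  { apply Rle_trans with (rsum N (fun _ => e / (INR N + 1))).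
    - apply rsum_le. intros k Hk; left; apply Hn; auto.
    - rewrite rsum_const. apply Rmult_le_reg_r with (INR N + 1); auto.
      replace (INR N * (e / (INR N + 1)) * (INR N + 1)) with (INR N * e) by (field; lra). nra. }
  destruct (nm_sub Hb Hp (trunc N (X n)) (trunc N (seq_sub (X n) y)) (mem_trunc Hb _ _) (mem_trunc Hb _ _)) as [_ H6].
  rewrite (nm_ext _ (trunc N y)) in H6.
  2:{ intros k; f_equal; unfold seq_sub, trunc; seqcase; ring. }
  lra.
Qed.

(* New indices are consed, so tuples are listed in decreasing order. *)
Fixpoint Hlim (G : list nat -> nat -> R) (j : nat) (l : list nat) : nat -> R :=
  match j with
  | O => G l
  | S j => fun k => ulim U (fun n => Hlim G j (n :: l) k)
  end.

Section IteratedLimits.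
Context {b : (nat -> R) -> R} (Hb : bnorm b) {p : R} (Hp : 1 <= p).
Context {G : list nat -> nat -> R} {K : nat} {C D : R}.
Context (HC : forall l, length l = K -> mem b p (G l) /\ nm b p (G l) <= C).
Context (HD : forall l1 a a' l2, length (l1 ++ a :: l2) = K ->
  nm b p (seq_sub (G (l1 ++ a :: l2)) (G (l1 ++ a' :: l2))) <= D).

Lemma wlim_vlim X : (forall n, mem b p (X n) /\ nm b p (X n) <= C) ->
  wlim X (fun k => ulim U (fun n => X n k)).
Proof.
  intros H k e He. apply (ulim_spec (fun n => X n k) C); auto.
  intros n. destruct (H n) as [H1 H2]. eapply Rle_trans; [apply (nm_coord Hb Hp); eauto|auto].
Qed.

Lemma Hlim_mem j l : (length l + j = K)%nat -> mem b p (Hlim G j l) /\ nm b p (Hlim G j l) <= C.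
Proof.
  revert l; induction j; intros l Hl; [apply HC; lia|].
  assert (H : forall n, mem b p (Hlim G j (n :: l)) /\ nm b p (Hlim G j (n :: l)) <= C)
    by (intros n; apply IHj; simpl; lia).
  apply (wlim_nm Hb Hp (fun n => Hlim G j (n :: l))); auto. apply wlim_vlim; auto.
Qed.

Lemma Hlim_wlim j l : (S (length l) + j = K)%nat -> wlim (fun n => Hlim G j (n :: l)) (Hlim G (S j) l).
Proof. intros Hl. apply wlim_vlim. intros n; apply Hlim_mem; simpl; lia. Qed.

Lemma Hlim_lip j l1 a a' l2 : (length (l1 ++ a :: l2) + j = K)%nat ->
  nm b p (seq_sub (Hlim G j (l1 ++ a :: l2)) (Hlim G j (l1 ++ a' :: l2))) <= D.
Proof.
  revert l1; induction j; intros l1 Hl; [apply HD; lia|].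
  assert (Hl' : (length (l1 ++ a' :: l2) + S j = K)%nat) by (rewrite length_app in *; simpl in *; lia).
  apply (wlim_nm Hb Hp (fun n => seq_sub (Hlim G j (n :: l1 ++ a :: l2)) (Hlim G j (n :: l1 ++ a' :: l2)))).
  - apply wlim_sub; apply Hlim_wlim; lia.
  - intros n; split.
    + apply (nm_sub Hb Hp); apply Hlim_mem; simpl; lia.
    + apply (IHj (n :: l1)). simpl; lia.
Qed.

(** The terms of the sequence defining the limit differ pairwise by at most [D], so by lower
    semicontinuity each differs from the limit by at most [D]. *)
Lemma Hlim_step j a l : (S (length l) + j = K)%nat ->
  nm b p (seq_sub (Hlim G j (a :: l)) (Hlim G (S j) l)) <= D.
Proof.
  intros Hl.
  apply (wlim_nm Hb Hp (fun n => seq_sub (Hlim G j (a :: l)) (Hlim G j (n :: l)))).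
  - apply wlim_sub; [apply wlim_const|apply Hlim_wlim; lia].
  - intros n; split.
    + apply (nm_sub Hb Hp); apply Hlim_mem; simpl; lia.
    + apply (Hlim_lip j [] a n l). simpl; lia.
Qed.

End IteratedLimits.
End Ultralimits.

(** The factor 2 creates room: [(2D)^p m + D^p] is strictly below [(2D)^p (m + 1)]. The gap [t]
    absorbs the tail of [x] and the head of [y], whose removal makes the two vectors disjoint. *)
Lemma almost_disjoint_step {b p} (Hb : bnorm b) (Hp : 1 <= p) x D m :
  mem b p x -> 0 < D -> nm b p x <= 2 * D * rpow (INR m) (/ p) ->
  exists e, 0 < e /\ exists N, forall y, mem b p y -> nm b p y <= D ->
    (forall k, (k < N)%nat -> Rabs (y k) < e) ->
    nm b p (sadd x y) <= 2 * D * rpow (INR (S m)) (/ p).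
Proof.
  intros Hx HD Hn.
  assert (Hip : 0 < / p) by (apply Rinv_0_lt_compat; lra).
  set (w := rpow (rpow (2 * D) p * INR m + rpow D p) (/ p)).
  assert (Hw : w < 2 * D * rpow (INR (S m)) (/ p)).
  { rewrite <- (rpow_root (2 * D) p) at 1 by lra.
    rewrite <- rpow_mul by (try apply rpow_ge0; apply pos_INR).
    unfold w. apply rpow_lt; auto.
    pose proof (rpow_ge0 (2 * D) p). pose proof (rpow_ge0 D p). pose proof (pos_INR m).
    assert (rpow D p < rpow (2 * D) p) by (apply rpow_lt; lra).
    rewrite S_INR; split; nra. }
  set (t := 2 * D * rpow (INR (S m)) (/ p) - w). assert (Ht : 0 < t) by (unfold t; lra).
  destruct (nm_tail_small Hb Hp x (t / 4) Hx ltac:(lra)) as [N HN].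
  assert (HN1 : 0 < INR N + 1) by (pose proof (pos_INR N); lra).
  exists (t / 4 / (INR N + 1)). split; [apply Rdiv_lt_0_compat; lra|].
  exists N. intros y Hy HyD Hk.
  assert (M1 := mem_trunc Hb (p := p) N x). assert (M2 := mem_tail Hb Hp N x Hx).
  assert (M3 := mem_trunc Hb (p := p) N y). assert (M4 := mem_tail Hb Hp N y Hy).
  assert (H1 : nmp b p (sadd (trunc N x) (tail N y)) <= rpow (2 * D) p * INR m + rpow D p).
  { eapply Rle_trans; [apply (nmp_disjoint Hb); auto|].
    { intros k; unfold trunc, tail; seqcase; auto. }
    apply Rplus_le_compat.
    - apply Rle_trans with (nmp b p x).
      + apply (nmp_mono Hb Hp); auto. intros k; unfold trunc; seqcase; rewrite ?Rabs_R0; [lra|apply Rabs_pos].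
      + rewrite <- (nm_pow Hb Hp). eapply Rle_trans; [apply rpow_le; [lra|exact Hn]|].
        rewrite rpow_mul, root_rpow by (try lra; try apply pos_INR; apply rpow_ge0). lra.
    - apply Rle_trans with (nmp b p y).
      + apply (nmp_mono Hb Hp); auto. intros k; unfold tail; seqcase; rewrite ?Rabs_R0; [apply Rabs_pos|lra].
      + rewrite <- (nm_pow Hb Hp). apply rpow_le; lra. }
  assert (H2 : nm b p (sadd (trunc N x) (tail N y)) <= w).
  { unfold nm, rroot. apply rpow_le; auto. }
  assert (H3 : nm b p (trunc N y) <= t / 4).
  { eapply Rle_trans; [apply (nm_trunc_le Hb Hp)|].
    apply Rle_trans with (rsum N (fun _ => t / 4 / (INR N + 1))).
    - apply rsum_le. intros k Hk'; left; apply Hk; auto.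
    - rewrite rsum_const. apply Rmult_le_reg_r with (INR N + 1); auto.
      replace (INR N * (t / 4 / (INR N + 1)) * (INR N + 1)) with (INR N * (t / 4)) by (field; lra). nra. }
  specialize (HN N (Nat.le_refl _)).
  destruct (nm_add Hb Hp (tail N x) (trunc N y) M2 M3) as [M5 H4].
  destruct (nm_add Hb Hp (trunc N x) (tail N y) M1 M4) as [M6 _].
  destruct (nm_add Hb Hp _ _ M6 M5) as [_ H5].
  rewrite (nm_ext _ (sadd x y)) in H5.
  2:{ intros k; f_equal; unfold sadd, trunc, tail; seqcase; ring. }
  unfold t in *; lra.
Qed.

Fixpoint sdec (l : list nat) : Prop :=
  match l with [] => True | a :: t => (forall c, In c t -> (c < a)%nat) /\ sdec t end.

(* Kalton-Randrianarivony concentration: along successively chosen indices, the increments of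
   the iterated weak limits are almost disjoint, so upper [qs i]-estimates apply. *)
Lemma concentration {U} (HU : ultra U) {b} (Hb : bnorm b) n (qs : nat -> R) (B : nat -> Prop)
  (G : nat -> list nat -> nat -> R) K C D N1 :
  0 < D ->
  (forall i, (i < n)%nat -> B i -> 1 <= qs i /\
     (forall l, length l = K -> mem b (qs i) (G i l) /\ nm b (qs i) (G i l) <= C) /\
     (forall l1 a a' l2, length (l1 ++ a :: l2) = K ->
        nm b (qs i) (seq_sub (G i (l1 ++ a :: l2)) (G i (l1 ++ a' :: l2))) <= D)) ->
  exists l, length l = K /\ sdec l /\ (forall a, In a l -> (N1 <= a)%nat) /\
    forall i, (i < n)%nat -> B i ->
      nm b (qs i) (seq_sub (G i l) (@Hlim U (G i) K [])) <= 2 * D * rpow (INR K) (/ qs i).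
Proof.
  intros HD H.
  (* Induction on the number [m] of indices already chosen; the other [K - m] are still replaced by
     limits. *)
  assert (Hm : forall m, (m <= K)%nat ->
    exists l, length l = m /\ sdec l /\ (forall a, In a l -> (N1 <= a)%nat) /\
    forall i, (i < n)%nat -> B i ->
      nm b (qs i) (seq_sub (@Hlim U (G i) (K - m) l) (@Hlim U (G i) K [])) <= 2 * D * rpow (INR m) (/ qs i)).
  2:{ destruct (Hm K (Nat.le_refl _)) as [l Hl]. exists l. rewrite Nat.sub_diag in Hl. exact Hl. }
  induction m; intros HmK.
  { exists []; simpl; repeat split; try tauto. intros i Hi HB. destruct (H i Hi HB) as [Hq _].
    rewrite Nat.sub_0_r, rpow_0, Rmult_0_r.
    rewrite (nm_ext _ (trunc 0 (fun _ => 0))); [apply (nm_trunc_le Hb Hq)|].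
    intros k; unfold seq_sub, trunc; seqcase. f_equal; ring. }
  destruct (IHm ltac:(lia)) as [l [Hl1 [Hl2 [Hl3 Hl4]]]].
  set (j := (K - S m)%nat). replace (K - m)%nat with (S j) in Hl4 by (unfold j; lia).
  assert (Hstep : exists e, 0 < e /\ forall i, (i < n)%nat -> B i -> exists N, forall y,
     mem b (qs i) y -> nm b (qs i) y <= D -> (forall k, (k < N)%nat -> Rabs (y k) < e) ->
     nm b (qs i) (sadd (seq_sub (@Hlim U (G i) (S j) l) (@Hlim U (G i) K [])) y)
       <= 2 * D * rpow (INR (S m)) (/ qs i)).
  { apply (uniform_pos n (fun i e => B i -> exists N, forall y,
     mem b (qs i) y -> nm b (qs i) y <= D -> (forall k, (k < N)%nat -> Rabs (y k) < e) ->
     nm b (qs i) (sadd (seq_sub (@Hlim U (G i) (S j) l) (@Hlim U (G i) K [])) y)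
       <= 2 * D * rpow (INR (S m)) (/ qs i))).
    - intros i e e' He He' HB. destruct (He HB) as [N HN]. exists N. intros y Hy1 Hy2 Hy3.
      apply HN; auto. intros k Hk; specialize (Hy3 k Hk); lra.
    - intros i Hi. destruct (classic (B i)) as [HB|HB]; [|exists 1; split; [lra|tauto]].
      destruct (H i Hi HB) as [Hq [HC' HD']].
      destruct (almost_disjoint_step Hb Hq _ D m
         (proj1 (nm_sub Hb Hq _ _ (proj1 (Hlim_mem HU Hb Hq HC' (S j) l ltac:(unfold j; lia)))
                   (proj1 (Hlim_mem HU Hb Hq HC' K [] eq_refl)))) HD (Hl4 i Hi HB)) as [e [He1 He2]].
      exists e; auto. }
  destruct Hstep as [e [He Hstep]].
  destruct (uniform_index n (fun i N => B i -> forall y,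
     mem b (qs i) y -> nm b (qs i) y <= D -> (forall k, (k < N)%nat -> Rabs (y k) < e) ->
     nm b (qs i) (sadd (seq_sub (@Hlim U (G i) (S j) l) (@Hlim U (G i) K [])) y)
       <= 2 * D * rpow (INR (S m)) (/ qs i))) as [N HN].
  { intros i Hi. destruct (classic (B i)) as [HB|HB]; [|exists O; tauto].
    destruct (Hstep i Hi HB) as [N HN]. exists N. intros N' HN' _ y Hy1 Hy2 Hy3.
    apply HN; auto. intros k Hk; apply Hy3; lia. }
  (* The increment caused by the next index tends to 0 in each coordinate, so the good indices form
     a large set; large sets being unbounded, one of them exceeds all earlier indices. *)
  assert (HUs : U (fun a => forall i, (i < n)%nat -> forall k, (k < N)%nat -> B i ->
     Rabs (@Hlim U (G i) j (a :: l) k - @Hlim U (G i) (S j) l k) < e)).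
  { apply (ultra_forall HU). intros i Hi. apply (ultra_forall HU). intros k Hk.
    destruct (classic (B i)) as [HB|HB]; [|apply (ultra_all HU); tauto].
    destruct (H i Hi HB) as [Hq [HC' HD']].
    eapply (ultra_mono U HU); [|apply (Hlim_wlim HU Hb Hq HC' j l ltac:(unfold j; lia) k e He)].
    auto. }
  assert (Hmax : exists A, forall c, In c l -> (c < A)%nat).
  { clear. induction l as [|a l [A HA]]; [exists O; simpl; tauto|].
    exists (S (Nat.max a A)). intros c [->|Hc]; [lia|]. specialize (HA c Hc); lia. }
  destruct Hmax as [A HA].
  destruct (ultra_inf U HU _ HUs (Nat.max N1 A)) as [a [Ha1 Ha2]].
  exists (a :: l). split; [simpl; lia|]. split; [|split].
  - simpl; split; auto. intros c Hc; specialize (HA c Hc); lia.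
  - intros c [<-|Hc]; [lia|auto].
  - intros i Hi HB. destruct (H i Hi HB) as [Hq [HC' HD']].
    pose proof (HN i N Hi (Nat.le_refl _) HB (seq_sub (@Hlim U (G i) j (a :: l)) (@Hlim U (G i) (S j) l))) as Hfin.
    rewrite (nm_ext (seq_sub (@Hlim U (G i) j (a :: l)) (@Hlim U (G i) K []))
      (sadd (seq_sub (@Hlim U (G i) (S j) l) (@Hlim U (G i) K []))
            (seq_sub (@Hlim U (G i) j (a :: l)) (@Hlim U (G i) (S j) l)))).
    + apply Hfin.
      * apply (nm_sub Hb Hq); apply (Hlim_mem HU Hb Hq HC'); simpl; unfold j; lia.
      * apply (Hlim_step HU Hb Hq HC' HD'); unfold j; lia.
      * intros k Hk. apply Ha2; auto.
    + intros k; f_equal; unfold sadd, seq_sub; ring.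
Qed.

(** * Approximate midpoints *)

Definition fsub (y z : nat -> nat -> R) : nat -> nat -> R := fun i => seq_sub (y i) (z i).
Definition ftrunc (N : nat) (y : nat -> nat -> R) : nat -> nat -> R := fun i => trunc N (y i).
Definition ftail (N : nat) (y : nat -> nat -> R) : nat -> nat -> R := fun i => tail N (y i).

Lemma rpow_le_exp d e1 e2 : 0 < d <= 1 -> e1 <= e2 -> rpow d e2 <= rpow d e1.
Proof.
  intros Hd He. unfold rpow; destruct (Rlt_dec 0 d); [|lra].
  unfold Rpower. assert (Hl : ln d <= 0) by (rewrite <- ln_1; destruct (proj2 Hd) as [H|H];
    [left; apply ln_increasing; lra|rewrite H; lra]).
  assert (H : e2 * ln d <= e1 * ln d) by nra.
  destruct H as [H|H]; [left; apply exp_increasing; auto|rewrite H; lra].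
Qed.

Lemma seq_sub_sadd x y : seq_sub x y = sadd x (sscal (-1) y).
Proof. apply functional_extensionality; intros k; unfold seq_sub, sadd, sscal; ring. Qed.

Section Renorming.
Context {b : (nat -> R) -> R} (Hb : bnorm b) {n : nat} {qs : nat -> R} {p r : R}.
Context (Hqs : forall i, (i < n)%nat -> 1 <= qs i) (Hr1 : 1 <= r).
Context (Hqr : forall i, (i < n)%nat -> qs i < p -> qs i < r).

Definition memF (y : nat -> nat -> R) : Prop := forall i, (i < n)%nat -> mem b (qs i) (y i).
(** Only exponents below [p] contribute. Summing [r]-th powers keeps the exact superadditivity
    between head and tail for the whole family. *)
Definition MA (y : nat -> nat -> R) : R :=
  rsum n (fun i => if Rlt_dec (qs i) p then Mr b (qs i) r (y i) else 0).
Definition NA (y : nat -> nat -> R) : R := rpow (MA y) (/ r).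

Lemma memF_sub x y : memF x -> memF y -> memF (fsub x y).
Proof. intros Hx Hy i Hi; apply (nm_sub Hb (Hqs i Hi)); auto. Qed.
Lemma memF_trunc N x : memF (ftrunc N x).
Proof. intros i Hi; apply (mem_trunc Hb). Qed.
Lemma memF_tail N x : memF x -> memF (ftail N x).
Proof. intros Hx i Hi; apply (mem_tail Hb (Hqs i Hi)); auto. Qed.

Lemma MA_ge0 y : 0 <= MA y.
Proof. apply rsum_ge0. intros i Hi. destruct (Rlt_dec _ _); [apply Mr_ge0|lra]. Qed.

Lemma NA_ge0 y : 0 <= NA y.
Proof. apply rpow_ge0. Qed.

Lemma NA_pow y : rpow (NA y) r = MA y.
Proof. apply root_rpow; [lra|apply MA_ge0]. Qed.

Lemma NA_sub x y : memF x -> memF y -> NA (fsub x y) <= NA x + NA y.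
Proof.
  intros Hx Hy. apply subadditive_root; auto using MA_ge0.
  intros l Hl. unfold MA. rewrite <- !rsum_scal, <- rsum_plus. apply rsum_le.
  intros i Hi. destruct (Rlt_dec (qs i) p) as [Hq|Hq]; [|lra].
  unfold fsub. rewrite seq_sub_sadd.
  destruct (nm_scal_le Hb (Hqs i Hi) (-1) (y i) (Hy i Hi)) as [Hm _].
  eapply Rle_trans; [apply (Mr_add Hb (Hqs i Hi) (Hqr i Hi Hq) l); auto|].
  apply Rplus_le_compat_l, Rmult_le_compat_l; [apply rpow_ge0|].
  eapply Rle_trans; [apply (Mr_scal_le Hb (Hqs i Hi) (Hqr i Hi Hq)); auto|].
  replace (Rabs (-1)) with 1 by (rewrite Rabs_left; lra). rewrite rpow_1_l; lra.
Qed.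

Lemma NA_split N y : memF y -> rpow (NA (ftrunc N y)) r + rpow (NA (ftail N y)) r <= rpow (NA y) r.
Proof.
  intros Hy. rewrite !NA_pow. unfold MA. rewrite <- rsum_plus. apply rsum_le.
  intros i Hi. destruct (Rlt_dec (qs i) p) as [Hq|Hq]; [|lra].
  apply (Mr_split Hb (Hqs i Hi) (Hqr i Hi Hq)); auto.
Qed.

Lemma NA_trunc_tail N y : memF y -> NA y <= NA (ftrunc N y) + NA (ftail N y).
Proof.
  intros Hy.
  (* With subtraction as the only operation on families, [fsub (fsub y y) w] serves as the negative
     of [w]. *)
  assert (E : y = fsub (ftrunc N y) (fsub (fsub y y) (ftail N y))).
  { apply functional_extensionality; intros i; apply functional_extensionality; intros k.
    unfold fsub, ftrunc, ftail, seq_sub, trunc, tail; seqcase; ring. }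
  assert (Z : NA (fsub y y) <= 0).
  { unfold NA. rewrite rpow_npos; [lra|].
    apply Rle_trans with (rsum n (fun _ => 0)); [|rewrite rsum_const; lra].
    apply rsum_le. intros i Hi. destruct (Rlt_dec (qs i) p) as [Hq|Hq]; [|lra].
    unfold fsub. replace (seq_sub (y i) (y i)) with (sscal 0 (y i))
      by (apply functional_extensionality; intros k; unfold seq_sub, sscal; ring).
    eapply Rle_trans; [apply (Mr_scal_le Hb (Hqs i Hi) (Hqr i Hi Hq)); auto|].
    rewrite Rabs_R0, rpow_0; lra. }
  rewrite E at 1.
  assert (H1 : memF (fsub y y)) by (apply memF_sub; auto).
  assert (H2 : memF (ftail N y)) by (apply memF_tail; auto).
  eapply Rle_trans; [apply NA_sub; [apply memF_trunc|apply memF_sub; auto]|].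
  pose proof (NA_sub _ _ H1 H2). lra.
Qed.

Lemma NA_coord i y : memF y -> (i < n)%nat -> qs i < p -> nm b (qs i) (y i) <= NA y.
Proof.
  intros Hy Hi Hq. eapply Rle_trans; [apply (nm_le_Mr Hb (Hqs i Hi) (Hqr i Hi Hq)); auto|].
  apply rpow_le; [apply Rinv_0_lt_compat; lra|].
  unfold MA. pose proof (rsum_term n (fun i => if Rlt_dec (qs i) p then Mr b (qs i) r (y i) else 0) i) as H.
  simpl in H. destruct (Rlt_dec (qs i) p); [|lra]. apply H; auto.
  intros j Hj. destruct (Rlt_dec _ _); [apply Mr_ge0|lra].
Qed.

Lemma NA_upper : exists C, 0 < C /\ forall y, memF y -> NA y <= C * rsum n (fun i => nm b (qs i) (y i)).
Proof.
  (* The [+ 1] keeps the constant positive even when no exponent lies below [p]. *)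
  set (CS := rsum n (fun i => if Rlt_dec (qs i) p then @lower_const (qs i) r else 0) + 1).
  assert (HCS : 0 < CS).
  { unfold CS. apply Rplus_le_lt_0_compat; [|lra]. apply rsum_ge0. intros i Hi.
    destruct (Rlt_dec (qs i) p) as [Hq|Hq]; [|lra].
    left; apply (lower_const_pos (Hqs i Hi) (Hqr i Hi Hq)). }
  exists (rpow CS (/ r)). split; [apply rpow_pos; auto|]. intros y Hy.
  set (s := rsum n (fun i => nm b (qs i) (y i))).
  assert (Hs : 0 <= s) by (apply rsum_ge0; intros; apply nm_ge0).
  assert (H : MA y <= CS * rpow s r).
  { unfold CS. rewrite Rmult_plus_distr_r, (Rmult_comm (rsum _ _)), <- rsum_scal.
    apply Rle_trans with (rsum n (fun i => rpow s r * (if Rlt_dec (qs i) p then @lower_const (qs i) r else 0))).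
    2:{ pose proof (rpow_ge0 s r); lra. }
    apply rsum_le. intros i Hi. destruct (Rlt_dec (qs i) p) as [Hq|Hq]; [|lra].
    eapply Rle_trans; [apply (Mr_le_nm Hb (Hqs i Hi) (Hqr i Hi Hq)); auto|].
    rewrite Rmult_comm. apply Rmult_le_compat_r.
    - left; apply (lower_const_pos (Hqs i Hi) (Hqr i Hi Hq)).
    - apply rpow_le; [lra|]. apply (rsum_term n (fun i => nm b (qs i) (y i))); auto. intros; apply nm_ge0. }
  unfold NA. eapply Rle_trans; [apply rpow_le; [apply Rinv_0_lt_compat; lra|exact H]|].
  rewrite rpow_mul, rpow_root; try lra. apply rpow_ge0.
Qed.

Lemma NA_tail_small y e : memF y -> 0 < e -> exists N, forall m, (N <= m)%nat -> NA (ftail m y) <= e.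
Proof.
  intros Hy He. destruct NA_upper as [C [HC H]].
  assert (Hn : 0 < INR n + 1) by (pose proof (pos_INR n); lra).
  assert (He' : 0 < e / (C * (INR n + 1))).
  { apply Rdiv_lt_0_compat; auto. apply Rmult_lt_0_compat; auto. }
  destruct (uniform_index n (fun i m => nm b (qs i) (tail m (y i)) <= e / (C * (INR n + 1)))) as [N HN].
  { intros i Hi. apply (nm_tail_small Hb (Hqs i Hi)); auto. }
  exists N. intros m Hm. eapply Rle_trans; [apply H; apply memF_tail; auto|].
  apply Rle_trans with (C * rsum n (fun _ => e / (C * (INR n + 1)))).
  - apply Rmult_le_compat_l; [lra|]. apply rsum_le. intros i Hi; apply HN; auto.
  - rewrite rsum_const. apply Rmult_le_reg_r with (INR n + 1); auto.
    replace (C * (INR n * (e / (C * (INR n + 1)))) * (INR n + 1)) with (INR n * e) by (field; lra). nra.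
Qed.

Lemma exists_infimum (S : R -> Prop) : (exists K, S K) -> (forall K, S K -> 0 <= K) ->
  exists L, 0 <= L /\ (forall K, S K -> L <= K) /\ forall e, 0 < e -> exists K, S K /\ K < L + e.
Proof.
  intros [K0 HK0] H0.
  destruct (completeness (fun t => S (- t))) as [s [Hs1 Hs2]].
  - exists 0. intros t Ht. specialize (H0 _ Ht). lra.
  - exists (- K0). rewrite Ropp_involutive; auto.
  - exists (- s). split; [|split].
    + assert (s <= 0); [|lra]. apply Hs2. intros t Ht. specialize (H0 _ Ht). lra.
    + intros K HK. assert (- K <= s); [|lra]. apply Hs1. rewrite Ropp_involutive; auto.
    + intros e He. apply NNPP; intros Hn.
      assert (s <= s - e); [|lra]. apply Hs2. intros t Ht. apply Rnot_lt_le; intros Hlt.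
      apply Hn. exists (- t); split; auto; lra.
Qed.

(** * Approximate midpoints in the source and in the target *)

Context {bs : (nat -> R) -> R} (Hbs : bnorm bs) (Hrp : r < p).
Context {f : (nat -> R) -> nat -> nat -> R} (Hf : forall x, mem bs p x -> memF (f x)).

(** The ratio [t] of the two bases satisfies [1 - t <= 8 d], so Bernoulli bounds the gap by a
    multiple of [d]. Its [r]-th root is the origin of the order [d^(1/r)] in the target. *)
Lemma rpow_gap X d : 0 < X -> 0 < d <= 1 / 2 ->
  rpow (X * (1 + 6 * d)) r - rpow (X * (1 - 2 * d)) r <= rpow (X * rpow (rpow 7 r * (8 * r) * d) (/ r)) r.
Proof.
  intros HX Hd.
  assert (H0 : 0 <= rpow 7 r * (8 * r) * d).
  { apply Rmult_le_pos; [apply Rmult_le_pos; [apply rpow_ge0|]|]; lra. }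
  rewrite (rpow_mul X (rpow _ (/ r))) by (try lra; apply rpow_ge0). rewrite root_rpow by lra.
  rewrite !(rpow_mul X) by lra.
  rewrite <- Rmult_minus_distr_l. apply Rmult_le_compat_l; [apply rpow_ge0|].
  set (t := (1 - 2 * d) / (1 + 6 * d)).
  assert (Ht : 0 <= t) by (apply Rle_mult_inv_pos; lra).
  replace (1 - 2 * d) with ((1 + 6 * d) * t) by (unfold t; field; lra).
  rewrite rpow_mul by lra. pose proof (rpow_bernoulli t r Ht Hr1) as H.
  assert (H2 : 1 - t <= 8 * d).
  { replace (1 - t) with (8 * d / (1 + 6 * d)) by (unfold t; field; lra).
    apply Rmult_le_reg_r with (1 + 6 * d); [lra|].
    unfold Rdiv; rewrite Rmult_assoc, Rinv_l by lra. nra. }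
  assert (H3 : rpow (1 + 6 * d) r <= rpow 7 r) by (apply rpow_le; lra).
  assert (H4 := rpow_ge0 (1 + 6 * d) r).
  apply Rle_trans with (rpow (1 + 6 * d) r * (8 * r * d)).
  2:{ rewrite (Rmult_assoc (rpow 7 r)). apply Rmult_le_compat_r; auto.
      apply Rmult_le_pos; lra. }
  assert (H5 : r * (1 - t) <= r * (8 * d)) by (apply Rmult_le_compat_l; lra).
  rewrite <- (Rmult_1_r (rpow (1 + 6 * d) r)) at 1. rewrite <- Rmult_minus_distr_l.
  apply Rmult_le_compat_l; auto. lra.
Qed.

(** Up to a tail of norm [d * nm bs p h], the vector [h] is disjoint from [z], and the upper
    estimate adds [p]-th powers: [1 + d <= (1 + d)^p]. Hence [z] may be as large as [d^(1/p)] times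
    the norm of [h]. *)
Lemma midpoint_dist a c z u h N0 d :
  mem bs p a -> mem bs p c -> mem bs p z -> (forall k, (k < N0)%nat -> z k = 0) ->
  0 < d ->
  h = sscal (1 / 2) (seq_sub a c) -> u = sadd c h ->
  nm bs p (tail N0 h) <= d * nm bs p h -> nm bs p z <= rpow d (/ p) * nm bs p h ->
  nm bs p (seq_sub (sadd u z) a) <= (1 + 2 * d) * nm bs p h /\
  nm bs p (seq_sub (sadd u z) c) <= (1 + 2 * d) * nm bs p h.
Proof.
  intros Ha Hc Hz Hz0 Hd Eh Eu Ht Hzn.
  assert (Hp : 1 <= p) by lra.
  assert (Mh : mem bs p h).
  { subst h; apply (nm_scal_le Hbs Hp). apply (nm_sub Hbs Hp); auto. }
  assert (Hh := nm_ge0 (b := bs) (p := p) h).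
  assert (Key : forall s, Rabs s = 1 -> nm bs p (sadd z (sscal s h)) <= (1 + 2 * d) * nm bs p h).
  { intros s Hs.
    destruct (nm_scal_le Hbs Hp s _ (mem_trunc Hbs N0 h)) as [M1 _].
    destruct (nm_scal_le Hbs Hp s _ (mem_tail Hbs Hp N0 h Mh)) as [M2 H2]. rewrite Hs in H2.
    assert (H1 : nm bs p (sadd z (sscal s (trunc N0 h))) <= (1 + d) * nm bs p h).
    { apply (nm_le_of_nmp Hbs Hp); [apply Rmult_le_pos; lra|].
      eapply Rle_trans; [apply (nmp_disjoint Hbs); auto|].
      { intros k. destruct (le_lt_dec N0 k); [right|left; auto]. unfold sscal, trunc; seqcase; ring. }
      destruct (nmp_scal_le Hbs s _ (mem_trunc Hbs (p := p) N0 h)) as [_ H3].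
      rewrite Hs, rpow_1_l, Rmult_1_l in H3.
      assert (H4 : nmp bs p (trunc N0 h) <= nmp bs p h).
      { apply (nmp_mono Hbs Hp); auto. intros k; unfold trunc; seqcase; rewrite ?Rabs_R0; [lra|apply Rabs_pos]. }
      assert (H5 : nmp bs p z <= d * nmp bs p h).
      { rewrite <- !(nm_pow Hbs Hp). eapply Rle_trans; [apply rpow_le; [lra|exact Hzn]|].
        rewrite rpow_mul, root_rpow by (try lra; apply rpow_ge0). lra. }
      rewrite rpow_mul, (nm_pow Hbs Hp) by lra.
      pose proof (rpow_bernoulli (1 + d) p ltac:(lra) Hp) as H6.
      pose proof (nmp_ge0 Hbs (p := p) h).
      apply Rle_trans with ((1 + d) * nmp bs p h); [lra|].
      apply Rmult_le_compat_r; auto. nra. }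
    destruct (nm_add Hbs Hp z _ Hz M1) as [M3 _].
    destruct (nm_add Hbs Hp _ _ M3 M2) as [_ H4].
    rewrite (nm_ext _ (sadd z (sscal s h))) in H4; [lra|].
    intros k; f_equal; unfold sadd, sscal, trunc, tail; seqcase; ring. }
  split.
  - specialize (Key (-1) ltac:(rewrite Rabs_left; lra)).
    erewrite nm_ext; [exact Key|]. intros k; f_equal; subst; unfold sadd, sscal, seq_sub; field.
  - specialize (Key 1 ltac:(rewrite Rabs_R1; lra)).
    erewrite nm_ext; [exact Key|]. intros k; f_equal; subst; unfold sadd, sscal, seq_sub; field.
Qed.

(** The tails of [fa] and [fb] being small, the heads of [fm - fa] and [fm - fb] have norms summing
    to at least [2 X (1 - 2 d)]. One head is thus almost as large as its whole vector, and
    [r]-superadditivity leaves little for the corresponding tail. *)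
Lemma target_midpoint fa fb fm N X d : memF fa -> memF fb -> memF fm -> 0 < X -> 0 < d <= 1 / 2 ->
  NA (fsub fm fa) <= X * (1 + 6 * d) -> NA (fsub fm fb) <= X * (1 + 6 * d) ->
  2 * X * (1 - d) <= NA (fsub fa fb) ->
  NA (ftail N fa) <= X * d -> NA (ftail N fb) <= X * d ->
  NA (ftail N fm) <= X * (rpow (rpow 7 r * (8 * r) * d) (/ r) + d).
Proof.
  intros Ma Mb Mm HX Hd H1 H2 H3 Ta Tb.
  assert (Case : forall y, memF y -> NA (fsub fm y) <= X * (1 + 6 * d) -> NA (ftail N y) <= X * d ->
     X * (1 - 2 * d) <= NA (ftrunc N (fsub fm y)) ->
     NA (ftail N fm) <= X * (rpow (rpow 7 r * (8 * r) * d) (/ r) + d)).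
  { intros y My Hy1 Hy2 Hy3.
    pose proof (NA_split N (fsub fm y) (memF_sub _ _ Mm My)) as Hs.
    assert (G1 : rpow (NA (fsub fm y)) r <= rpow (X * (1 + 6 * d)) r) by (apply rpow_le; lra).
    assert (G2 : rpow (X * (1 - 2 * d)) r <= rpow (NA (ftrunc N (fsub fm y))) r) by (apply rpow_le; lra).
    pose proof (rpow_gap X d HX Hd) as G3.
    assert (G4 : NA (ftail N (fsub fm y)) <= X * rpow (rpow 7 r * (8 * r) * d) (/ r)).
    { apply rpow_le_inv with r; [lra|apply Rmult_le_pos; [lra|apply rpow_ge0]|lra]. }
    assert (Z : forall y, memF y -> NA (fsub (fsub y y) y) <= NA y).
    { intros w Mw. right. unfold NA, MA. f_equal. apply rsum_ext. intros i Hi.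
      destruct (Rlt_dec _ _); auto. unfold Mr. f_equal. apply functional_extensionality; intros v.
      f_equal. apply functional_extensionality; intros l. f_equal. f_equal.
      induction l as [|ab l IH]; simpl; auto. rewrite IH. f_equal. f_equal. apply nm_ext.
      intros k. unfold seg, fsub, seq_sub; destruct (_ && _)%bool; auto.
      rewrite Rminus_diag, Rminus_0_l, Rabs_Ropp; auto. }
    assert (E : ftail N fm = fsub (ftail N (fsub fm y)) (fsub (fsub (ftail N y) (ftail N y)) (ftail N y))).
    { apply functional_extensionality; intros i; apply functional_extensionality; intros k.
      unfold fsub, ftail, seq_sub, tail; seqcase; ring. }
    rewrite E.
    assert (Mt : memF (ftail N y)) by (apply memF_tail; auto).
    eapply Rle_trans; [apply NA_sub; [apply memF_tail, memF_sub; auto|repeat apply memF_sub; auto]|].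
    specialize (Z _ Mt). lra. }
  assert (HV : 2 * X * (1 - 2 * d) <= NA (ftrunc N (fsub fm fb)) + NA (ftrunc N (fsub fm fa))).
  { pose proof (NA_trunc_tail N (fsub fa fb) (memF_sub _ _ Ma Mb)) as G1.
    assert (G2 : NA (ftail N (fsub fa fb)) <= NA (ftail N fa) + NA (ftail N fb)).
    { replace (ftail N (fsub fa fb)) with (fsub (ftail N fa) (ftail N fb)).
      - apply NA_sub; apply memF_tail; auto.
      - apply functional_extensionality; intros i; apply functional_extensionality; intros k.
        unfold fsub, ftail, seq_sub, tail; seqcase; ring. }
    assert (G3 : NA (ftrunc N (fsub fa fb)) <= NA (ftrunc N (fsub fm fb)) + NA (ftrunc N (fsub fm fa))).
    { replace (ftrunc N (fsub fa fb)) with (fsub (ftrunc N (fsub fm fb)) (ftrunc N (fsub fm fa))).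
      - apply NA_sub; apply memF_trunc.
      - apply functional_extensionality; intros i; apply functional_extensionality; intros k.
        unfold fsub, ftrunc, seq_sub, trunc; seqcase; ring. }
    lra. }
  destruct (Rle_lt_dec (X * (1 - 2 * d)) (NA (ftrunc N (fsub fm fa)))) as [Hc|Hc].
  - apply (Case fa); auto.
  - apply (Case fb); auto. lra.
Qed.

(** The set [S] collects the slopes valid up to some additive constant, so its infimum [L] ignores
    bounded scales. Midpoints are needed only for [L > 0]; for [L = 0] the map itself contracts
    large balls. *)
Lemma compression K0 :
  (forall x y, mem bs p x -> mem bs p y -> NA (fsub (f x) (f y)) <= K0 * nm bs p (seq_sub x y) + K0) ->
  0 <= K0 ->
  forall eps s0, 0 < eps -> 0 < s0 ->
  exists s u N0 N, s0 <= s /\ mem bs p u /\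
    forall z, mem bs p z -> (forall k, (k < N0)%nat -> z k = 0) -> nm bs p z <= s ->
      NA (ftail N (f (sadd u z))) <= eps * s.
Proof.
  intros HK HK0 eps s0 Heps Hs0.
  assert (Hp : 1 <= p) by lra.
  set (S := fun K => 0 <= K /\ exists c, forall x y, mem bs p x -> mem bs p y ->
       NA (fsub (f x) (f y)) <= K * nm bs p (seq_sub x y) + c).
  destruct (exists_infimum S) as [L [HL0 [HL1 HL2]]].
  { exists K0; split; eauto. }
  { intros K [H _]; auto. }
  destruct HL0 as [HL0|HL0].
  - (* positive optimal slope: take an almost extremal pair *)
    assert (Hg : 0 < / r - / p).
    { apply Rlt_0_minus. apply Rinv_lt_contravar; [apply Rmult_lt_0_compat; lra|auto]. }
    set (CR := rpow 7 r * (8 * r)).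
    assert (HCR : 0 < CR) by (apply Rmult_lt_0_compat; [apply rpow_pos|]; lra).
    set (c3 := L * (rpow CR (/ r) + 1)).
    assert (Hc3 : 0 < c3).
    { apply Rmult_lt_0_compat; auto. pose proof (rpow_ge0 CR (/ r)); lra. }
    (* The tails will be bounded by [c3 * d^(1/r) * dd] on a ball of radius [d^(1/p) * dd]; since
       [1/r > 1/p], a small [d] makes the quotient at most [eps]. *)
    destruct (rpow_small (/ r - / p) (eps / c3) Hg ltac:(apply Rdiv_lt_0_compat; auto)) as [d [Hd Hde]].
    assert (Hdp : 0 < rpow d (/ p)) by (apply rpow_pos; lra).
    destruct (HL2 (L * d) ltac:(apply Rmult_lt_0_compat; lra)) as [K1 [[HK1 [c1 Hc1]] HK1L]].
    set (c1' := Rmax c1 0). assert (Hc1' : c1 <= c1' /\ 0 <= c1') by (split; [apply Rmax_l|apply Rmax_r]).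
    (* At half-distances beyond [d0] the additive constant is at most [L d] times the half-distance,
       and the final radius is at least [s0]. *)
    set (d0 := Rmax (c1' / (L * d)) (s0 / rpow d (/ p))).
    assert (HLd : 0 < L * d) by (apply Rmult_lt_0_compat; lra).
    assert (Hd01 : c1' <= d0 * (L * d)).
    { apply Rle_trans with (c1' / (L * d) * (L * d)); [right; field; lra|].
      apply Rmult_le_compat_r; [lra|apply Rmax_l]. }
    assert (Hd02 : s0 <= rpow d (/ p) * d0).
    { apply Rle_trans with (rpow d (/ p) * (s0 / rpow d (/ p))); [right; field; lra|].
      apply Rmult_le_compat_l; [lra|apply Rmax_r]. }
    assert (Hd00 : 0 < d0).
    { eapply Rlt_le_trans; [|apply Rmax_r]. apply Rdiv_lt_0_compat; auto. }
    (* The slope [L (1 - d)] fails for every additive constant. Compared with the upper bound of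
       slope [K1 < L + L d], failure for this constant forces half-distance at least [d0]. *)
    set (c' := c1' + 4 * (L * d) * d0).
    assert (Hpair : exists a c, mem bs p a /\ mem bs p c /\
       L * (1 - d) * nm bs p (seq_sub a c) + c' < NA (fsub (f a) (f c))).
    { apply NNPP; intros Hn.
      assert (HS : S (L * (1 - d))).
      { split; [apply Rmult_le_pos; lra|]. exists c'. intros x y Hx Hy.
        apply Rnot_lt_le; intros Hlt; apply Hn; eauto. }
      specialize (HL1 _ HS). nra. }
    destruct Hpair as [a [c [Ma [Mc Hac]]]].
    set (h := sscal (1 / 2) (seq_sub a c)).
    assert (Mac : mem bs p (seq_sub a c)) by (apply (nm_sub Hbs Hp); auto).
    assert (Mh : mem bs p h) by (apply (nm_scal_le Hbs Hp); auto).
    assert (Eh : nm bs p (seq_sub a c) = 2 * nm bs p h).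
    { unfold h. rewrite (nm_scal Hbs Hp), Rabs_pos_eq by (auto; lra). field. }
    set (dd := nm bs p h). assert (Hdd0 : 0 <= dd) by apply nm_ge0.
    assert (Hdd : d0 <= dd).
    { pose proof (Hc1 a c Ma Mc) as H1. rewrite Eh in H1, Hac. fold dd in H1, Hac.
      assert (H2 : K1 * (2 * dd) <= (L + L * d) * (2 * dd)) by (apply Rmult_le_compat_r; lra).
      unfold c' in Hac. apply Rmult_le_reg_l with (4 * (L * d)); lra. }
    set (u := sadd c h).
    assert (Mu : mem bs p u) by (apply (nm_add Hbs Hp); auto).
    destruct (nm_tail_small Hbs Hp h (d * dd) Mh ltac:(apply Rmult_lt_0_compat; lra)) as [N0 HN0].
    specialize (HN0 N0 (Nat.le_refl _)).
    set (X := L * dd). assert (HX : 0 < X) by (apply Rmult_lt_0_compat; lra).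
    destruct (NA_tail_small (f a) (X * d) (Hf a Ma) ltac:(apply Rmult_lt_0_compat; lra)) as [N1 HN1].
    destruct (NA_tail_small (f c) (X * d) (Hf c Mc) ltac:(apply Rmult_lt_0_compat; lra)) as [N2 HN2].
    exists (rpow d (/ p) * dd), u, N0, (Nat.max N1 N2). split; [|split; auto].
    { eapply Rle_trans; [exact Hd02|]. apply Rmult_le_compat_l; lra. }
    intros z Mz Hz0 Hzn.
    destruct (midpoint_dist a c z u h N0 d Ma Mc Mz Hz0 ltac:(lra) eq_refl eq_refl HN0 Hzn) as [D1 D2].
    fold dd in D1, D2.
    assert (Muz : mem bs p (sadd u z)) by (apply (nm_add Hbs Hp); auto).
    (* Slope [L (1 + d)], distance [(1 + 2 d) dd] and additive constant [L d dd] combine to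
       [(1 + d)(1 + 2 d) + d <= 1 + 6 d], as [d <= 1/2]. *)
    assert (Up : forall y, mem bs p y -> nm bs p (seq_sub (sadd u z) y) <= (1 + 2 * d) * dd ->
       NA (fsub (f (sadd u z)) (f y)) <= X * (1 + 6 * d)).
    { intros y My Hy. eapply Rle_trans; [apply Hc1; auto|].
      assert (H1 : K1 * nm bs p (seq_sub (sadd u z) y) <= (L + L * d) * ((1 + 2 * d) * dd)).
      { apply Rmult_le_compat; auto; try lra. apply nm_ge0. }
      assert (H2 : d0 * (L * d) <= dd * (L * d)) by (apply Rmult_le_compat_r; lra).
      unfold X.
      apply Rle_trans with ((L + L * d) * ((1 + 2 * d) * dd) + dd * (L * d)); [lra|].
      replace ((L + L * d) * ((1 + 2 * d) * dd) + dd * (L * d)) with (L * dd * ((1 + d) * (1 + 2 * d) + d)) by ring.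
      apply Rmult_le_compat_l; [fold X; lra|]. nra. }
    assert (Hlow : 2 * X * (1 - d) <= NA (fsub (f a) (f c))).
    { rewrite Eh in Hac. fold dd in Hac. unfold c' in Hac.
      assert (0 <= 4 * (L * d) * d0) by (apply Rmult_le_pos; lra). unfold X. lra. }
    pose proof (target_midpoint (f a) (f c) (f (sadd u z)) (Nat.max N1 N2) X d (Hf a Ma) (Hf c Mc)
      (Hf _ Muz) HX Hd (Up a Ma D1) (Up c Mc D2) Hlow (HN1 _ (Nat.le_max_l _ _)) (HN2 _ (Nat.le_max_r _ _))) as Hfin.
    eapply Rle_trans; [exact Hfin|]. fold CR.
    rewrite rpow_mul by lra.
    assert (H1 : d <= rpow d (/ r)).
    { rewrite <- (rpow_1_r d) at 1 by lra. apply rpow_le_exp; [lra|].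
      rewrite <- Rinv_1. apply Rinv_le_contravar; lra. }
    assert (H2 : rpow d (/ r) = rpow d (/ r - / p) * rpow d (/ p)).
    { rewrite <- rpow_plus by lra. f_equal; ring. }
    apply Rle_trans with (X * ((rpow CR (/ r) + 1) * rpow d (/ r))).
    { apply Rmult_le_compat_l; lra. }
    rewrite H2. unfold X.
    replace (L * dd * ((rpow CR (/ r) + 1) * (rpow d (/ r - / p) * rpow d (/ p))))
      with (c3 * rpow d (/ r - / p) * (rpow d (/ p) * dd)) by (unfold c3; ring).
    apply Rmult_le_compat_r; [apply Rmult_le_pos; lra|].
    apply Rle_trans with (c3 * (eps / c3)); [apply Rmult_le_compat_l; lra|]. right; field; lra.
  (* Three quarters of [eps * s] are spent: on the slope, on the additive constant, which [s]
     dominates, and on the tail of [f u]. *)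
  - destruct (HL2 (eps / 4) ltac:(lra)) as [K [[HKp [c Hc]] HKe]]. rewrite <- HL0 in HKe.
    set (u := fun _ : nat => 0).
    assert (Mu : mem bs p u) by (apply (mem_fin Hbs u 0); auto).
    set (s := Rmax s0 (Rmax c 0 * (4 / eps))).
    assert (Hs1 : s0 <= s) by apply Rmax_l.
    assert (Hs2 : c <= eps / 4 * s).
    { apply Rle_trans with (Rmax c 0); [apply Rmax_l|].
      apply Rle_trans with (eps / 4 * (Rmax c 0 * (4 / eps))); [right; field; lra|].
      apply Rmult_le_compat_l; [lra|apply Rmax_r]. }
    destruct (NA_tail_small (f u) (eps / 4 * s) (Hf u Mu) ltac:(apply Rmult_lt_0_compat; lra)) as [N HN].
    exists s, u, O, N. split; [auto|split; [auto|]].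
    intros z Mz _ Hz.
    assert (Muz : mem bs p (sadd u z)) by (apply (nm_add Hbs Hp); auto).
    assert (M1 : memF (fsub (f u) (f (sadd u z)))) by (apply memF_sub; auto).
    pose proof (Hc u (sadd u z) Mu Muz) as H1.
    rewrite (nm_ext (seq_sub u (sadd u z)) z) in H1.
    2:{ intros k; unfold seq_sub, sadd, u. rewrite Rplus_0_l, Rminus_0_l, Rabs_Ropp; auto. }
    assert (H2 : K * nm bs p z <= eps / 4 * s) by (apply Rmult_le_compat; try lra; apply nm_ge0).
    assert (H3 : NA (ftail N (fsub (f u) (f (sadd u z)))) <= NA (fsub (f u) (f (sadd u z)))).
    { apply rpow_le_inv with r; [lra|apply NA_ge0|].
      pose proof (NA_split N _ M1). pose proof (rpow_ge0 (NA (ftrunc N (fsub (f u) (f (sadd u z))))) r). lra. }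
    replace (ftail N (f (sadd u z))) with (fsub (ftail N (f u)) (ftail N (fsub (f u) (f (sadd u z))))).
    2:{ apply functional_extensionality; intros i; apply functional_extensionality; intros k.
        unfold fsub, ftail, seq_sub, tail; seqcase; ring. }
    eapply Rle_trans; [apply NA_sub; apply memF_tail; auto|].
    specialize (HN N (Nat.le_refl _)). assert (0 <= eps * s) by (apply Rmult_le_pos; lra). lra.
Qed.

End Renorming.

(** * The contradiction *)

Definition zl (c : R) (l : list nat) : nat -> R := fun k => c * lsum (fun a => ev a k) l.

Lemma zl_cons c a l : zl c (a :: l) = sadd (sscal c (ev a)) (zl c l).
Proof. apply functional_extensionality; intros k; unfold zl, sadd, sscal; simpl; ring. Qed.

Lemma zl_notin c l k : ~ In k l -> zl c l k = 0.
Proof.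
  induction l as [|a l IH]; intros H; [unfold zl; simpl; ring|].
  rewrite zl_cons; unfold sadd, sscal. rewrite IH by (simpl in H; tauto).
  unfold ev. destruct (Nat.eqb_spec k a); [simpl in H; subst; tauto|ring].
Qed.

Lemma zl_in c l k : sdec l -> In k l -> zl c l k = c.
Proof.
  induction l as [|a l IH]; intros Hs Hk; simpl in Hk; [tauto|]. destruct Hs as [H1 H2].
  rewrite zl_cons; unfold sadd, sscal. unfold ev. destruct (Nat.eqb_spec k a) as [->|Hn].
  - rewrite zl_notin; [ring|]. intros Hin; specialize (H1 _ Hin); lia.
  - destruct Hk as [->|Hk]; [congruence|]. rewrite IH; auto; ring.
Qed.

(** Tuples are listed downwards and chains upwards, hence the reversal. *)
Lemma sdec_chain lo l : sdec l -> (forall a, In a l -> (lo <= a)%nat) ->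
  chain lo (map (fun a => (a, S a)) (rev l)).
Proof.
  intros Hs Hlo. induction l as [|a l IH]; simpl; auto.
  destruct Hs as [H1 H2]. rewrite map_app. apply chain_app with a.
  - apply Hlo; left; auto.
  - apply IH; auto. intros; apply Hlo; right; auto.
  - intros ab Hab. apply in_map_iff in Hab. destruct Hab as [c [<- Hc]]. apply in_rev in Hc.
    specialize (H1 _ Hc). simpl; lia.
  - simpl; lia.
Qed.

Lemma sdec_app l l' : sdec l -> sdec l' -> (forall a c, In a l -> In c l' -> (c < a)%nat) -> sdec (l ++ l').
Proof.
  induction l as [|a l IH]; simpl; intros H H' Hac; auto.
  destruct H as [H1 H2]. split; auto.
  intros c Hc. apply in_app_or in Hc. destruct Hc as [Hc|Hc]; auto.
Qed.

Section SourceVectors.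
Context {b : (nat -> R) -> R} (Hb : bnorm b) {p : R} (Hp : 1 <= p).

Lemma zl_mem c l : mem b p (zl c l).
Proof.
  induction l as [|a l IH].
  - apply (mem_fin Hb _ 0). intros; apply zl_notin; simpl; auto.
  - rewrite zl_cons. apply (nm_add Hb Hp); auto. apply (nm_scal_le Hb Hp). apply (mem_ev Hb).
Qed.

Lemma nmp_unit c a : 0 <= c -> nmp b p (sscal c (ev a)) <= rpow c p.
Proof.
  intros Hc. destruct (nmp_scal_le Hb c (ev a) (mem_ev Hb (p := p) a)) as [_ H].
  rewrite Rabs_pos_eq in H by auto. rewrite <- (nm_pow Hb Hp (ev a)), (nm_ev Hb), rpow_1_l in H. lra.
Qed.

Lemma zl_upper c l : 0 <= c -> sdec l -> nmp b p (zl c l) <= INR (length l) * rpow c p.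
Proof.
  intros Hc. induction l as [|a l IH]; intros Hs.
  - simpl. rewrite Rmult_0_l. rewrite <- (nm_pow Hb Hp), rpow_npos; [lra|].
    rewrite (nm_ext _ (trunc 0 (fun _ => 0))); [apply (nm_trunc_le Hb Hp)|].
    intros k; f_equal; unfold zl, trunc; seqcase; ring.
  - destruct Hs as [H1 H2]. rewrite zl_cons. simpl length. rewrite S_INR.
    eapply Rle_trans; [apply (nmp_disjoint Hb)|].
    + apply (nm_scal_le Hb Hp), (mem_ev Hb).
    + apply zl_mem.
    + intros k. destruct (Nat.eq_dec k a) as [->|Hn].
      * right. apply zl_notin. intros Hin; specialize (H1 _ Hin); lia.
      * left. unfold sscal, ev. destruct (Nat.eqb_spec k a); [lia|ring].
    + specialize (IH H2). pose proof (nmp_unit c a Hc). lra.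
Qed.

(** The cost of changing one index does not grow with the length of the tuple: this is the Lipschitz
    bound for the Hamming distance that concentration needs. *)
Lemma zl_swap c l1 a a' l2 : 0 <= c ->
  nm b p (seq_sub (zl c (l1 ++ a :: l2)) (zl c (l1 ++ a' :: l2))) <= 2 * c.
Proof.
  intros Hc.
  rewrite (nm_ext _ (seq_sub (sscal c (ev a)) (sscal c (ev a')))).
  2:{ intros k; f_equal; unfold zl, seq_sub, sscal. rewrite !lsum_app; simpl; ring. }
  assert (H : forall a, nm b p (sscal c (ev a)) = c).
  { intros e. rewrite (nm_scal Hb Hp), (nm_ev Hb), Rabs_pos_eq by (auto; apply (mem_ev Hb)). ring. }
  eapply Rle_trans; [apply (nm_sub Hb Hp); apply (nm_scal_le Hb Hp), (mem_ev Hb)|].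
  rewrite !H; lra.
Qed.

(** Valid for lists with repetitions too, over which the iterated limits also run; it supplies their
    boundedness. *)
Lemma zl_triangle c l : 0 <= c -> nm b p (zl c l) <= INR (length l) * c.
Proof.
  intros Hc. induction l as [|a l IH].
  - simpl. rewrite (nm_ext _ (trunc 0 (fun _ => 0))); [eapply Rle_trans; [apply (nm_trunc_le Hb Hp)|simpl; lra]|].
    intros k; f_equal; unfold zl, trunc; seqcase; ring.
  - rewrite zl_cons. simpl length. rewrite S_INR.
    eapply Rle_trans; [apply (nm_add Hb Hp); [apply (nm_scal_le Hb Hp), (mem_ev Hb)|apply zl_mem]|].
    rewrite (nm_scal Hb Hp), (nm_ev Hb), Rabs_pos_eq by (auto; apply (mem_ev Hb)). lra.
Qed.

(** Singletons lying beyond their own number form an admissible family, so the lower l_1-estimate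
    applies to the [p]-th powers. *)
Lemma singles_lower c l x : 0 <= c -> mem b p x -> sdec l -> (forall a, In a l -> (length l <= a)%nat) ->
  (forall a, In a l -> c <= Rabs (x a)) -> INR (length l) * rpow c p <= 2 * nmp b p x.
Proof.
  intros Hc Hx Hs Hl Hxa.
  pose proof (nmp_low Hb (p := p) x (length l) (map (fun a => (a, S a)) (rev l)) Hx
    (sdec_chain _ l Hs Hl)) as H.
  rewrite length_map, length_rev in H. specialize (H ltac:(lia)).
  eapply Rle_trans; [|exact H]. rewrite lsum_map.
  rewrite <- (length_rev l). apply lsum_lower. intros a Ha. apply in_rev in Ha.
  rewrite <- (nm_pow Hb Hp). apply rpow_le; [lra|].
  eapply Rle_trans; [apply (Hxa a Ha)|].
  pose proof (nm_coord Hb Hp (seg (a, S a) x) a (mem_seg Hb _ _)) as H1.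
  unfold seg at 1 in H1. simpl in H1. rewrite Nat.leb_refl in H1. simpl in H1.
  destruct (Nat.ltb_spec a (S a)); [exact H1|lia].
Qed.

End SourceVectors.

Lemma between_exponents n (qs : nat -> R) p : 1 < p ->
  exists r, 1 <= r < p /\ forall i, (i < n)%nat -> qs i < p -> qs i < r.
Proof.
  intros Hp. induction n as [|n [r [Hr H]]]; [exists 1; split; [lra|lia]|].
  exists (Rmax r (if Rlt_dec (qs n) p then (qs n + p) / 2 else 1)). split.
  - split; [eapply Rle_trans; [|apply Rmax_l]; lra|]. apply Rmax_lub_lt; [lra|].
    destruct (Rlt_dec _ _); lra.
  - intros i Hi Hq. destruct (Nat.eq_dec i n) as [->|Hn].
    + eapply Rlt_le_trans; [|apply Rmax_r]. destruct (Rlt_dec _ _); lra.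
    + eapply Rlt_le_trans; [|apply Rmax_l]. apply H; auto; lia.
Qed.

Lemma INR_rpow_small g e : 0 < g -> 0 < e ->
  exists N, forall m, (N <= m)%nat -> 0 < INR m /\ rpow (INR m) (- g) <= e.
Proof.
  intros Hg He. destruct (INR_unbounded (rpow (/ e) (/ g))) as [N HN].
  exists N. intros m Hm.
  assert (Hi : 0 < / e) by (apply Rinv_0_lt_compat; auto).
  assert (H1 : 0 < rpow (/ e) (/ g)) by (apply rpow_pos; auto).
  assert (H2 : INR N <= INR m) by (apply le_INR; auto).
  assert (H3 : 0 < INR m) by lra. split; auto.
  assert (H4 : / e <= rpow (INR m) g).
  { rewrite <- (root_rpow (/ e) g) by lra. apply rpow_le; lra. }
  assert (H5 : rpow (INR m) (- g) * rpow (INR m) g = 1).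
  { rewrite <- rpow_plus by auto. replace (- g + g) with 0 by ring.
    unfold rpow; destruct (Rlt_dec _ _); [apply Rpower_O; auto|lra]. }
  assert (H6 := rpow_ge0 (INR m) (- g)).
  assert (H7 : rpow (INR m) (- g) * / e <= 1) by (rewrite <- H5; apply Rmult_le_compat_l; auto).
  apply Rmult_le_compat_r with (r := e) in H7; [|lra].
  rewrite Rmult_assoc, Rinv_l in H7 by lra. lra.
Qed.

(** * Compression and concentration on the same tuples *)

Section NoEmbedding.
Context {bs b : (nat -> R) -> R} (Hbs : bnorm bs) (Hb : bnorm b).
Context {n : nat} {qs : nat -> R} {p : R} (Hp : 1 <= p).
Context (Hqs : forall i, (i < n)%nat -> 1 <= qs i).
Context {f : (nat -> R) -> nat -> nat -> R} {L : R} (HL : 0 < L).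
Context (Hf : forall x, mem bs p x -> @memF b n qs (f x)).
Context (Hup : forall x y, mem bs p x -> mem bs p y ->
  rsum n (fun i => nm b (qs i) (seq_sub (f x i) (f y i))) <= L * nm bs p (seq_sub x y) + L).

Lemma small_exponents_compress eps s0 : 0 < eps -> 0 < s0 ->
  exists s u N0 N, s0 <= s /\ mem bs p u /\
    forall z, mem bs p z -> (forall k, (k < N0)%nat -> z k = 0) -> nm bs p z <= s ->
      forall i, (i < n)%nat -> qs i < p -> nm b (qs i) (tail N (f (sadd u z) i)) <= eps * s.
Proof.
  intros He Hs0.
  destruct (classic (exists i, (i < n)%nat /\ qs i < p)) as [[i0 [Hi0 Hq0]]|Hno].
  - destruct (between_exponents n qs p) as [r [Hr Hqr]].
    { specialize (Hqs i0 Hi0); lra. }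
    assert (Hr1 : 1 <= r) by lra. assert (Hrp : r < p) by lra.
    destruct (NA_upper Hb (p := p) Hqs Hr1 Hqr) as [C [HC HCu]].
    destruct (compression Hb Hqs Hr1 Hqr Hbs Hrp Hf (C * L)) with (eps := eps) (s0 := s0)
      as [s [u [N0 [N [H1 [H2 H3]]]]]]; auto.
    + intros x y Hx Hy. eapply Rle_trans; [apply HCu; apply (memF_sub Hb Hqs); auto|].
      specialize (Hup x y Hx Hy). unfold fsub.
      apply Rle_trans with (C * (L * nm bs p (seq_sub x y) + L)); [apply Rmult_le_compat_l; lra|lra].
    + apply Rmult_le_pos; lra.
    + exists s, u, N0, N. repeat split; auto. intros z Hz1 Hz2 Hz3 i Hi Hq.
      eapply Rle_trans; [|apply (H3 z Hz1 Hz2 Hz3)].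
      assert (Mz : mem bs p (sadd u z)) by (apply (nm_add Hbs Hp); auto).
      apply (NA_coord Hb Hqs Hr1 Hqr i (ftail N (f (sadd u z)))); auto.
      apply (memF_tail Hb Hqs); auto.
  - exists s0, (fun _ => 0), O, O. split; [lra|]. split; [apply (mem_fin Hbs _ 0); auto|].
    intros z _ _ _ i Hi Hq. exfalso; eauto.
Qed.

Lemma component_le x y i : mem bs p x -> mem bs p y -> (i < n)%nat ->
  nm b (qs i) (seq_sub (f x i) (f y i)) <= L * nm bs p (seq_sub x y) + L.
Proof.
  intros Hx Hy Hi. eapply Rle_trans; [|apply Hup; auto].
  apply (rsum_term n (fun i => nm b (qs i) (seq_sub (f x i) (f y i)))); auto.
  intros; apply nm_ge0.
Qed.

Context (Hne : forall i, (i < n)%nat -> p <> qs i).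
Context (Hlow : forall x y, mem bs p x -> mem bs p y ->
  nm bs p (seq_sub x y) / L - L <= rsum n (fun i => nm b (qs i) (seq_sub (f x i) (f y i)))).

Lemma no_embedding : False.
Proof.
  destruct ultra_exists as [U HU].
  assert (Hn : 0 < INR n + 1) by (pose proof (pos_INR n); lra).
  (* Chosen so that [n] components of size [(12 L + 3) e1 s] sum to at most [s / (2 L)], half of the
     main term [s / L] of the lower bound. *)
  set (e1 := / ((INR n + 1) * (12 * L + 3) * (2 * L))).
  assert (He1 : 0 < e1).
  { apply Rinv_0_lt_compat. repeat apply Rmult_lt_0_compat; lra. }
  assert (HK : exists K, (1 <= K)%nat /\ forall i, (i < n)%nat -> p < qs i -> rpow (INR K) (/ qs i - / p) <= e1).
  { destruct (uniform_index n (fun i m => p < qs i -> rpow (INR m) (/ qs i - / p) <= e1)) as [N HN].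
    - intros i Hi. destruct (Rlt_dec p (qs i)) as [Hq|Hq]; [|exists O; intros; lra].
      destruct (INR_rpow_small (/ p - / qs i) e1) as [N HN]; auto.
      { apply Rlt_0_minus. apply Rinv_lt_contravar; [apply Rmult_lt_0_compat; lra|auto]. }
      exists N. intros m Hm _. destruct (HN m Hm) as [_ H].
      replace (/ qs i - / p) with (- (/ p - / qs i)) by ring. auto.
    - exists (S N). split; [lia|]. intros i Hi Hq. apply HN; auto; lia. }
  destruct HK as [K [HK1 HK2]].
  assert (HKr : 0 < INR K) by (apply lt_0_INR; lia).
  set (kap := rpow (INR K) (/ p)). assert (Hkap : 0 < kap) by (apply rpow_pos; auto).
  (* The bound [kap <= s] gives [c >= 1], and [s > 2 L^2] makes [s / L - L] exceed [s / (2 L)]. *)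
  destruct (small_exponents_compress e1 (Rmax kap (2 * L * L + 1)) He1) as [s [u [N0 [N [Hs [Mu Hz]]]]]].
  { eapply Rlt_le_trans; [exact Hkap|apply Rmax_l]. }
  assert (Hs1 : kap <= s) by (eapply Rle_trans; [apply Rmax_l|exact Hs]).
  assert (Hs2 : 2 * L * L + 1 <= s) by (eapply Rle_trans; [apply Rmax_r|exact Hs]).
  set (c := s / kap).
  assert (Hc1 : 1 <= c).
  { unfold c. apply Rmult_le_reg_r with kap; auto. unfold Rdiv; rewrite Rmult_assoc, Rinv_l; lra. }
  assert (Eck : c * kap = s) by (unfold c; field; lra).
  clearbody c.
  assert (Mz : forall l, mem bs p (sadd u (zl c l))).
  { intros l; apply (nm_add Hbs Hp); auto. apply (zl_mem Hbs Hp). }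
  set (G := fun i l => f (sadd u (zl c l)) i).
  (* One swap costs [2 L c], and the additive constant is at most [L c]. *)
  set (D := 3 * L * c).
  assert (HD : 0 < D) by (unfold D; apply Rmult_lt_0_compat; lra).
  set (C := rsum n (fun i => nm b (qs i) (f u i)) + (L * (INR K * c) + L)).
  assert (HC : forall i l, (i < n)%nat -> length l = K -> mem b (qs i) (G i l) /\ nm b (qs i) (G i l) <= C).
  { intros i l Hi Hl. split; [apply Hf; auto|].
    pose proof (component_le (sadd u (zl c l)) u i (Mz l) Mu Hi) as H1.
    rewrite (nm_ext (seq_sub (sadd u (zl c l)) u) (zl c l)) in H1
      by (intros k; f_equal; unfold seq_sub, sadd; ring).
    pose proof (zl_triangle Hbs Hp c l ltac:(lra)) as H2. rewrite Hl in H2.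
    pose proof (rsum_term n (fun i => nm b (qs i) (f u i)) i ltac:(intros; apply nm_ge0) Hi) as H3. simpl in H3.
    destruct (nm_sub Hb (Hqs i Hi) _ _ (Hf _ (Mz l) i Hi) (Hf _ Mu i Hi)) as [M1 _].
    destruct (nm_add Hb (Hqs i Hi) _ _ M1 (Hf _ Mu i Hi)) as [_ H4].
    rewrite (nm_ext _ (G i l)) in H4
      by (intros k; f_equal; unfold G, sadd, seq_sub; ring).
    assert (L * nm bs p (zl c l) <= L * (INR K * c)) by (apply Rmult_le_compat_l; lra).
    unfold C. lra. }
  (* Beyond [N0] the vectors lie in the subspace of [small_exponents_compress]; beyond [2 * K] the
     union of two tuples is admissible; beyond [t] a later tuple can be placed after an earlier
     one. *)
  assert (Htup : forall t, exists l, length l = K /\ sdec l /\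
     (forall a, In a l -> (Nat.max t (Nat.max N0 (2 * K)) <= a)%nat) /\
     forall i, (i < n)%nat -> p < qs i ->
       nm b (qs i) (seq_sub (G i l) (@Hlim U (G i) K [])) <= 2 * D * rpow (INR K) (/ qs i)).
  { intros t. apply (concentration HU Hb n qs (fun i => p < qs i) G K C D); auto.
    intros i Hi Hq. split; [auto|]. split; [intros l Hl; apply HC; auto|].
    intros l1 a a' l2 Hl.
    pose proof (component_le _ _ i (Mz (l1 ++ a :: l2)) (Mz (l1 ++ a' :: l2)) Hi) as H1.
    rewrite (nm_ext (b := bs) (p := p) _ (seq_sub (zl c (l1 ++ a :: l2)) (zl c (l1 ++ a' :: l2)))) in H1
      by (intros k; f_equal; unfold seq_sub, sadd; ring).
    pose proof (zl_swap Hbs Hp c l1 a a' l2 ltac:(lra)) as H2.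
    unfold D, G.
    apply Rle_trans with (L * (2 * c) + L * c).
    2: lra.
    eapply Rle_trans; [exact H1|]. apply Rplus_le_compat; [apply Rmult_le_compat_l; lra|].
    rewrite <- (Rmult_1_r L) at 1. apply Rmult_le_compat_l; lra. }
  set (lt := fun t => proj1_sig (constructive_indefinite_description _ (Htup t))).
  assert (Hlt : forall t, length (lt t) = K /\ sdec (lt t) /\
     (forall a, In a (lt t) -> (Nat.max t (Nat.max N0 (2 * K)) <= a)%nat) /\
     forall i, (i < n)%nat -> p < qs i ->
       nm b (qs i) (seq_sub (G i (lt t)) (@Hlim U (G i) K [])) <= 2 * D * rpow (INR K) (/ qs i))
    by (intros t; exact (proj2_sig (constructive_indefinite_description _ (Htup t)))).
  clearbody lt. clear Htup.
  set (eta := e1 * s / (2 * (INR N + 1))).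
  assert (HN1 : 0 < INR N + 1) by (pose proof (pos_INR N); lra).
  assert (Hes : 0 < e1 * s) by (apply Rmult_lt_0_compat; lra).
  assert (Heta : 0 < eta) by (apply Rdiv_lt_0_compat; lra).
  (* Stands in for compactness: two tuples from this large set have images agreeing within [2 * eta]
     in each coordinate below [N], hence within [e1 * s] in norm there. *)
  assert (HUs : U (fun t => forall i, (i < n)%nat -> forall k, (k < N)%nat ->
     Rabs (G i (lt t) k - ulim U (fun t => G i (lt t) k)) < eta)).
  { apply (ultra_forall HU). intros i Hi. apply (ultra_forall HU). intros k Hk.
    apply (ulim_spec HU (fun t => G i (lt t) k) C); auto. intros t.
    destruct (HC i (lt t) Hi (proj1 (Hlt t))) as [H1 H2].
    eapply Rle_trans; [apply (nm_coord Hb (Hqs i Hi)); auto|auto]. }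
  destruct (ultra_inf U HU _ HUs O) as [t1 [_ Ht1]].
  assert (Hmax : exists A, forall a, In a (lt t1) -> (a < A)%nat).
  { generalize (lt t1) as l. clear. induction l as [|a l [A HA]]; [exists O; simpl; tauto|].
    exists (S (Nat.max a A)). intros d [->|Hc]; [lia|]. specialize (HA d Hc); lia. }
  destruct Hmax as [A HA].
  destruct (ultra_inf U HU _ HUs A) as [t2 [Ht2A Ht2]].
  destruct (Hlt t1) as [L1 [S1 [G1 B1]]]. destruct (Hlt t2) as [L2 [S2 [G2 B2]]].
  set (l1 := lt t1) in *. set (l2 := lt t2) in *.
  assert (Hzs : forall l, length l = K -> sdec l -> nm bs p (zl c l) <= s).
  { intros l Hl Hsd. apply (nm_le_of_nmp Hbs Hp); [lra|].
    eapply Rle_trans; [apply (zl_upper Hbs Hp); [lra|auto]|].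
    rewrite Hl, <- Eck, rpow_mul by lra. unfold kap. rewrite root_rpow by lra. lra. }
  assert (Hz0 : forall l, (forall a, In a l -> (N0 <= a)%nat) -> forall k, (k < N0)%nat -> zl c l k = 0).
  { intros l Hl k Hk. apply zl_notin. intros Hin. specialize (Hl _ Hin); lia. }
  (* Small exponents contribute one head and two tails, each at most [e1 s]; large ones contribute
     two distances of at most [6 L e1 s] to the common limit. *)
  assert (Hcomp : forall i, (i < n)%nat -> nm b (qs i) (seq_sub (G i l1) (G i l2)) <= (12 * L + 3) * (e1 * s)).
  { intros i Hi.
    assert (Q := Hqs i Hi).
    destruct (HC i l1 Hi L1) as [MG1 _]. destruct (HC i l2 Hi L2) as [MG2 _].
    destruct (Rtotal_order (qs i) p) as [Hq|[Hq|Hq]].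
    - pose proof (Hz _ (zl_mem Hbs Hp c l1) (Hz0 l1 ltac:(intros a Ha; specialize (G1 a Ha); lia))
        (Hzs l1 L1 S1) i Hi Hq) as T1.
      pose proof (Hz _ (zl_mem Hbs Hp c l2) (Hz0 l2 ltac:(intros a Ha; specialize (G2 a Ha); lia))
        (Hzs l2 L2 S2) i Hi Hq) as T2.
      fold (G i l1) in T1. fold (G i l2) in T2.
      pose proof (nm_trunc_le Hb Q N (seq_sub (G i l1) (G i l2))) as T3.
      assert (T4 : rsum N (fun k => Rabs (seq_sub (G i l1) (G i l2) k)) <= e1 * s).
      { apply Rle_trans with (rsum N (fun _ => 2 * eta)).
        - apply rsum_le. intros k Hk. specialize (Ht1 i Hi k Hk). specialize (Ht2 i Hi k Hk).
          unfold seq_sub.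
          replace (G i l1 k - G i l2 k) with ((G i l1 k - ulim U (fun t => G i (lt t) k))
             - (G i l2 k - ulim U (fun t => G i (lt t) k))) by ring.
          eapply Rle_trans; [apply Rabs_triang|]. rewrite Rabs_Ropp. lra.
        - rewrite rsum_const. unfold eta. apply Rmult_le_reg_r with (INR N + 1); auto.
          replace (INR N * (2 * (e1 * s / (2 * (INR N + 1)))) * (INR N + 1)) with (INR N * (e1 * s)) by (field; lra).
          nra. }
      destruct (nm_sub Hb Q _ _ (mem_tail Hb Q N _ MG1) (mem_tail Hb Q N _ MG2)) as [M1 T5].
      destruct (nm_add Hb Q _ _ (mem_trunc Hb N (seq_sub (G i l1) (G i l2))) M1) as [_ T6].
      rewrite (nm_ext _ (seq_sub (G i l1) (G i l2))) in T6.
      2:{ intros k; f_equal; unfold sadd, seq_sub, trunc, tail; seqcase; ring. }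
      assert (0 <= 12 * L * (e1 * s)) by (apply Rmult_le_pos; lra). lra.
    - exfalso; apply (Hne i Hi); auto.
    - specialize (B1 i Hi Hq). specialize (B2 i Hi Hq).
      assert (MH : mem b (qs i) (@Hlim U (G i) K [])).
      { apply (Hlim_mem HU Hb Q (K := K) (C := C)); auto. }
      destruct (nm_sub Hb Q _ _ MG1 MH) as [M1 _]. destruct (nm_sub Hb Q _ _ MG2 MH) as [M2 _].
      destruct (nm_sub Hb Q _ _ M1 M2) as [_ T].
      rewrite (nm_ext _ (seq_sub (G i l1) (G i l2))) in T by (intros k; f_equal; unfold seq_sub; ring).
      assert (E : c * rpow (INR K) (/ qs i) = s * rpow (INR K) (/ qs i - / p)).
      { rewrite <- Eck. unfold kap. rewrite Rmult_assoc, <- rpow_plus by auto.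
        do 2 f_equal. ring. }
      specialize (HK2 i Hi Hq).
      assert (T2 : 2 * D * rpow (INR K) (/ qs i) <= 6 * L * (e1 * s)).
      { unfold D. replace (2 * (3 * L * c) * rpow (INR K) (/ qs i)) with (6 * L * (c * rpow (INR K) (/ qs i))) by ring.
        rewrite E. apply Rmult_le_compat_l; [lra|]. rewrite (Rmult_comm e1). apply Rmult_le_compat_l; lra. }
      lra. }
  assert (Hdist : s <= nm bs p (seq_sub (sadd u (zl c l1)) (sadd u (zl c l2)))).
  { rewrite (nm_ext _ (seq_sub (zl c l1) (zl c l2))) by (intros k; f_equal; unfold seq_sub, sadd; ring).
    assert (M := proj1 (nm_sub Hbs Hp _ _ (zl_mem Hbs Hp c l1) (zl_mem Hbs Hp c l2))).
    assert (Hgt : forall a d, In a l2 -> In d l1 -> (d < a)%nat).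
    { intros a d Ha Hd. specialize (HA d Hd). specialize (G2 a Ha). lia. }
    (* The union has [2 K] coordinates of modulus [c]; the 2 cancels that of the lower estimate and
       leaves [K c^p = s^p]. *)
    pose proof (singles_lower Hbs Hp c (l2 ++ l1) _ ltac:(lra) M (sdec_app _ _ S2 S1 Hgt)) as H.
    rewrite length_app, L1, L2 in H.
    assert (Hn1 : forall a, In a (l2 ++ l1) -> (K + K <= a)%nat).
    { intros a Ha. apply in_app_or in Ha. destruct Ha as [Ha|Ha]; [specialize (G2 a Ha)|specialize (G1 a Ha)]; lia. }
    specialize (H Hn1).
    apply rpow_le_inv with p; [lra|apply nm_ge0|]. rewrite (nm_pow Hbs Hp).
    rewrite <- Eck, rpow_mul by lra. unfold kap. rewrite root_rpow by lra.
    rewrite plus_INR in H.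
    assert (Hx : forall a, In a (l2 ++ l1) -> c <= Rabs (seq_sub (zl c l1) (zl c l2) a)).
    { intros a Ha. unfold seq_sub. apply in_app_or in Ha. destruct Ha as [Ha|Ha].
      - rewrite (zl_in c l2 a S2 Ha), zl_notin, Rminus_0_l, Rabs_Ropp, Rabs_pos_eq; try lra.
        intros Hin. specialize (Hgt a a Ha Hin); lia.
      - rewrite (zl_in c l1 a S1 Ha), zl_notin, Rminus_0_r, Rabs_pos_eq; try lra.
        intros Hin. specialize (Hgt a a Hin Ha); lia. }
    specialize (H Hx). lra. }
  pose proof (Hlow _ _ (Mz l1) (Mz l2)) as Hfin.
  assert (Hsum : rsum n (fun i => nm b (qs i) (seq_sub (f (sadd u (zl c l1)) i) (f (sadd u (zl c l2)) i)))
     <= INR n * ((12 * L + 3) * (e1 * s))).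
  { rewrite <- rsum_const. apply rsum_le. intros i Hi. apply Hcomp; auto. }
  assert (Hb1 : INR n * ((12 * L + 3) * (e1 * s)) <= s / (2 * L)).
  { apply Rle_trans with ((INR n + 1) * ((12 * L + 3) * (e1 * s))).
    - apply Rmult_le_compat_r; [apply Rmult_le_pos; lra|lra].
    - right. unfold e1. field. repeat split; lra. }
  assert (Hb2 : s / L <= nm bs p (seq_sub (sadd u (zl c l1)) (sadd u (zl c l2))) / L).
  { apply Rmult_le_compat_r; [left; apply Rinv_0_lt_compat; auto|auto]. }
  assert (Hb3 : s / L - L <= s / (2 * L)) by lra.
  apply Rmult_le_compat_r with (r := 2 * L) in Hb3; [|lra].
  replace ((s / L - L) * (2 * L)) with (2 * s - 2 * L * L) in Hb3 by (field; lra).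
  replace (s / (2 * L) * (2 * L)) with s in Hb3 by (field; lra).
  lra.
Qed.

End NoEmbedding.

(** * From the abstract statement to the spaces of the theorem *)

Lemma no_coarse_lip_embedding bs n ps p (inA : (nat -> R) -> Prop) (dA : (nat -> R) -> (nat -> R) -> R) :
  bnorm bs -> 1 <= p -> (forall i, (i < n)%nat -> 1 <= ps i) -> (forall i, (i < n)%nat -> p <> ps i) ->
  (forall x, inA x <-> mem bs p x) -> (forall x y, inA x -> inA y -> dA x y = nm bs p (seq_sub x y)) ->
  ~ coarse_lip_embeds inA dA (in_sumTp n ps) (sumTp_dist n ps).
Proof.
  intros Hbs Hp Hps Hne HA HdA [f [Hf [L [HL Hcl]]]].
  assert (HT := tsir_bnorm).
  assert (HfM : forall x, mem bs p x -> @memF tsir_c00 n ps (f x)).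
  { intros x Hx i Hi. apply in_Tp_mem; auto. apply Hf; auto. apply HA; auto. }
  assert (Ed : forall x y, mem bs p x -> mem bs p y ->
     sumTp_dist n ps (f x) (f y) = rsum n (fun i => nm tsir_c00 (ps i) (seq_sub (f x i) (f y i)))).
  { intros x y Hx Hy. apply rsum_ext. intros i Hi. apply Tp_norm_nm.
    apply (nm_sub HT (Hps i Hi)); apply HfM; auto. }
  apply (@no_embedding bs tsir_c00 Hbs HT n ps p Hp Hps f L HL HfM); auto.
  - intros x y Hx Hy. rewrite <- Ed by auto.
    (* Taking [t] to be the distance of the pair turns the modulus into a two-point inequality. *)
    destruct (Hcl (nm bs p (seq_sub x y)) (nm_ge0 _)) as [H _].
    apply H; try apply HA; auto. rewrite HdA by (apply HA; auto); lra.
  - intros x y Hx Hy. rewrite <- Ed by auto.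
    destruct (Hcl (nm bs p (seq_sub x y)) (nm_ge0 _)) as [_ H].
    apply Rge_le, H; try apply HA; auto. rewrite HdA by (apply HA; auto); lra.
Qed.

Lemma Tp_not_embeds n ps p : 1 <= p -> (forall i, (i < n)%nat -> 1 <= ps i) ->
  (forall i, (i < n)%nat -> p <> ps i) ->
  ~ coarse_lip_embeds (in_Tp p) (Tp_dist p) (in_sumTp n ps) (sumTp_dist n ps).
Proof.
  intros Hp Hps Hne. apply (no_coarse_lip_embedding tsir_c00 n ps p); auto.
  - apply tsir_bnorm.
  - intros x; apply in_Tp_mem; auto.
  - intros x y Hx Hy. apply Tp_norm_nm. apply (nm_sub tsir_bnorm Hp); apply in_Tp_mem; auto.
Qed.

Lemma lp_not_embeds n ps p : 1 <= p -> (forall i, (i < n)%nat -> 1 <= ps i) ->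
  (forall i, (i < n)%nat -> p <> ps i) ->
  ~ coarse_lip_embeds (in_lp p) (lp_dist p) (in_sumTp n ps) (sumTp_dist n ps).
Proof.
  intros Hp Hps Hne. apply (no_coarse_lip_embedding l1norm n ps p); auto.
  - apply l1_bnorm.
  - intros x; apply in_lp_mem; auto.
  - intros x y Hx Hy. apply lp_norm_nm. apply (nm_sub l1_bnorm Hp); apply in_lp_mem; auto.
Qed.

Theorem theorem1p3 :
  (forall (n : nat) (ps : nat -> R) (p : R),
     (1 <= n)%nat ->
     1 <= ps 0%nat ->
     (forall i, (S i < n)%nat -> ps i < ps (S i)) ->
     1 <= p ->
     (forall i, (i < n)%nat -> p <> ps i) ->
     ~ coarse_lip_embeds (in_Tp p) (Tp_dist p) (in_sumTp n ps) (sumTp_dist n ps) /\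
     ~ coarse_lip_embeds (in_lp p) (lp_dist p) (in_sumTp n ps) (sumTp_dist n ps))
  /\
  (forall p q : R, 1 <= p -> 1 <= q -> p <> q ->
     ~ coarse_lip_embeds (in_Tp p) (Tp_dist p) (in_Tp q) (Tp_dist q)).
Proof.
  split.
  - intros n ps p Hn H0 Hinc Hp Hne.
    assert (Hps : forall i, (i < n)%nat -> 1 <= ps i).
    { induction i as [|i IH]; intros Hi; auto.
      specialize (IH ltac:(lia)). specialize (Hinc i Hi). lra. }
    split; [apply Tp_not_embeds|apply lp_not_embeds]; auto.
  - intros p q Hp Hq Hpq [f [Hf [L [HL Hcl]]]].
    apply (Tp_not_embeds 1 (fun _ => q) p); auto.
    exists (fun x i => match i with O => f x | S _ => fun _ => 0 end). split.
    + intros x Hx. split.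
      * intros [|i] Hi; [apply Hf; auto|lia].
      * intros [|i] k Hi; [lia|auto].
    + exists L. split; auto. intros t Ht. destruct (Hcl t Ht) as [H1 H2]. split.
      * intros x y Hx Hy Hd. unfold sumTp_dist; simpl. rewrite Rplus_0_l. apply H1; auto.
      * intros x y Hx Hy Hd. unfold sumTp_dist; simpl. rewrite Rplus_0_l. apply H2; auto.
Qed.
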